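(* Let $(\mathbb G,Y)$ be a finite graph of groups with finitely generated vertex groups $\{G_v\mid v\in Y^0\}$ and edge groups $\{G_e\mid e\in Y^1_+\}$, and let $\mathbb T$ be a maximal tree of $Y$. Then $$\operatorname{asdim}\pi_1(\mathbb G,Y,\mathbb T)\le \max_{v\in Y^0,\ e\in Y^1_+}\{\operatorname{asdim}G_v,\ \operatorname{asdim}G_e+1\}.$$
   Context: For a metric space $X$, $\operatorname{asdim}X\le n$ means: for every $R>0$ there is a covering $\mathcal U$ of $X$ by sets of uniformly bounded diameter such that every $R$-ball in $X$ intersects at most $n+1$ elements of $\mathcal U$; $\operatorname{asdim}X$ is the least such $n$ ($\infty$ if there is none). A finitely generated group is viewed as a metric space with the word metric of a finite generating set; a subgroup of a finitely generated group carries the restricted metric (so each edge group, embedded in a vertex group, has a well-defined asdim). $Y$ is a finite connected graph with vertex set $Y^0$; $Y^1_+$ is the set of its edges with a chosen orientation (one for each geometric edge); $\pi_1(\mathbb G,Y,\mathbb T)$ is the Bass–Serre fundamental group of the graph of groups with respect to $\mathbb T$. *)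

(* Defs.v *)
From HB Require Import structures.
From mathcomp Require Import all_boot all_order all_algebra finmap.
From mathcomp Require Import boolp classical_sets cardinality reals
  constructive_ereal ereal topology.

Set Implicit Arguments.
Unset Strict Implicit.
Unset Printing Implicit Defensive.

Import Order.TTheory GRing.Theory Num.Theory.

Local Open Scope classical_set_scope.
Local Open Scope card_scope.
Local Open Scope quotient_scope.
Local Open Scope ring_scope.

Section AsymptoticDimension.
Context {R : realType} (X : metricType R).

Definition uniformly_bounded (U : set (set X)) : Prop :=
  exists D : R, forall A, U A -> forall x y, A x -> A y -> mdist x y <= D.

Definition asdim_le (n : nat) : Prop :=
  forall r : R, 0 < r -> exists U : set (set X),
    [/\ \bigcup_(A in U) A = setT,
        uniformly_bounded U
      & forall x : X, [set A | U A /\ A `&` ball x r !=set0] #<= `I_n.+1].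

Definition asdim : \bar R := ereal_inf [set n%:R%:E | n in asdim_le].

Lemma asdim_leP (n : nat) : (asdim <= n%:R%:E)%E <-> asdim_le n.
Proof.
split=> [len|Xn]; last by apply: ereal_inf_lbound; exists n.
suff [m [Xm mn]] : exists m, asdim_le m /\ (m <= n)%N.
  move=> r /Xm[U [covU bdU cardU]]; exists U; split=> // x.
  apply: (card_le_trans (cardU x)).
  by apply: subset_card_le => k /=; rewrite !ltnS => /leq_trans; apply.
apply: contrapT => noth; suff : (n.+1%:R%:E <= asdim)%E.
  by move=> /le_trans/(_ len); rewrite lee_fin ler_nat ltnn.
apply: le_ereal_inf_tmp => _ [m Xm <-].
rewrite lee_fin ler_nat ltnNge; apply/negP => mn.
by apply: noth; exists m.
Qed.

End AsymptoticDimension.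

(* A metric restricted along an injection, e.g. that of a subgroup. *)
Definition pullback {X : choiceType} {Y : Type} {f : X -> Y}
  (f_inj : injective f) : Type := X.

Section Pullback.
Context {R : realType} {X : choiceType} {Y : metricType R} {f : X -> Y}.
Variable f_inj : injective f.

HB.instance Definition _ := Choice.on (pullback f_inj).

Let dist (x y : pullback f_inj) : R := mdist (f x) (f y).

Let distxx x : dist x x = 0. Proof. exact: mdistxx. Qed.
Let dist_eq0 x y : dist x y = 0 -> x = y.
Proof. by move=> /mdist_positivity/f_inj. Qed.
Let distC x y : dist x y = dist y x. Proof. exact: metric_sym. Qed.
Let dist_triangle y x z : dist x z <= dist x y + dist y z.
Proof. exact: metric_triangle. Qed.

HB.instance Definition _ :=
  @isMetric.Build R (pullback f_inj) dist distxx dist_eq0 distC dist_triangle.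

End Pullback.

Section WordLength.
Local Open Scope group_scope.
Context {G : groupType}.

Definition spelled (S : {fset G}) (g : G) (w : seq G) : Prop :=
  all [pred x | (x \in S) || (x^-1 \in S)] w /\ \prod_(x <- w) x = g.

Definition generates (S : {fset G}) : Prop := forall g, exists w, spelled S g w.

End WordLength.

Record genset (G : groupType) :=
  Genset { gens :> {fset G}; gensP : generates gens }.

Section WordMetric.
Local Open Scope group_scope.
Context {G : groupType}.
Variable S : genset G.

Lemma ex_word_len (g : G) :
  exists n, `[< exists w, spelled S g w /\ size w = n >].
Proof. by have [w gw] := gensP S g; exists (size w); apply/asboolP; exists w. Qed.

Definition word_len (g : G) : nat := ex_minn (ex_word_len g).

Lemma word_lenP g : exists2 w, spelled S g w & size w = word_len g.
Proof.
by rewrite /word_len; case: ex_minnP => n /asboolP[w [gw <-]] _; exists w.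
Qed.

Lemma word_len_le g w : spelled S g w -> (word_len g <= size w)%N.
Proof.
move=> gw; rewrite /word_len; case: ex_minnP => n _; apply.
by apply/asboolP; exists w.
Qed.

Lemma word_len1 : word_len 1 = 0%N.
Proof.
apply/eqP; rewrite -leqn0; apply: (@word_len_le 1 [::]).
by split; rewrite ?big_nil.
Qed.

Lemma word_len_eq0 g : word_len g = 0%N -> g = 1.
Proof.
by have [w [_ <-] <-] := word_lenP g => /size0nil ->; rewrite big_nil.
Qed.

Lemma word_lenV_le g : (word_len g^-1 <= word_len g)%N.
Proof.
have [w [Sw <-] <-] := word_lenP g.
rewrite -(size_rev w) -(size_map (fun x => x^-1) (rev w)); apply: word_len_le; split.
  rewrite all_map all_rev; apply: sub_all Sw => x /=.
  by rewrite invgK orbC.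
elim: w {Sw} => [|x w IHw]; first by rewrite !big_nil invg1.
by rewrite rev_cons map_rcons big_rcons /= IHw big_cons invgM.
Qed.

Lemma word_lenV g : word_len g^-1 = word_len g.
Proof.
by apply/eqP; rewrite eqn_leq word_lenV_le -{1}(invgK g) word_lenV_le.
Qed.

Lemma word_lenM g h : (word_len (g * h) <= word_len g + word_len h)%N.
Proof.
have [w [Sw <-] <-] := word_lenP g; have [u [Su <-] <-] := word_lenP h.
rewrite -size_cat; apply: word_len_le; split; first by rewrite all_cat Sw.
by rewrite big_cat.
Qed.

End WordMetric.

Definition word_space (R : realType) {G : groupType} (S : genset G) : Type := G.

Section WordSpace.
Context {R : realType} {G : groupType}.
Variable S : genset G.

HB.instance Definition _ := Choice.on (word_space R S).

Let dist (g h : word_space R S) : R :=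
  (word_len S ((g : G)^-1 * (h : G))%g)%:R.

Let distxx x : dist x x = 0.
Proof. by rewrite /dist mulVg word_len1. Qed.

Let dist_eq0 x y : dist x y = 0 -> x = y.
Proof.
move=> /eqP; rewrite pnatr_eq0 => /eqP/word_len_eq0 xy1.
by apply: (@mulgI G (x : G)^-1%g); rewrite xy1 mulVg.
Qed.

Let distC x y : dist x y = dist y x.
Proof. by rewrite /dist -word_lenV invgM invgK. Qed.

Let dist_triangle y x z : dist x z <= dist x y + dist y z.
Proof.
rewrite /dist -natrD ler_nat; apply: leq_trans (word_lenM _ _ _).
by rewrite -mulgA mulVKg.
Qed.

HB.instance Definition _ :=
  @isMetric.Build R (word_space R S) dist distxx dist_eq0 distC dist_triangle.

End WordSpace.

(* A finite graph with one chosen orientation of each geometric edge: [edge]   *)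
(* is the set Y^1_+, with [edge_end e true] the terminal and [edge_end e false] *)
(* the initial vertex of e. Serre's set of all oriented edges is [oedge],       *)
(* (e, true) being e and (e, false) its reverse. Loops and multiple edges are   *)
(* allowed.                                                                     *)
Record graph := Graph {
  vert : finType;
  edge : finType;
  edge_end : edge -> bool -> vert
}.

Section Graph.
Variable Y : graph.

Definition oedge : Type := (edge Y * bool)%type.
HB.instance Definition _ := Finite.on oedge.

Definition orev (y : oedge) : oedge := (y.1, ~~ y.2).
Definition oterm (y : oedge) : vert Y := edge_end y.1 y.2.
Definition oorg (y : oedge) : vert Y := oterm (orev y).

Record subgraph := Subgraph {
  sverts : {set vert Y};
  sedges : {set edge Y};
  sub_ends : forall y : oedge, y.1 \in sedges -> oterm y \in sverts
}.

Definition full_subgraph : subgraph :=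
  @Subgraph finset.setT finset.setT (fun y _ => finset.in_setT (oterm y)).

Definition sub_adj (T : subgraph) : rel (vert Y) :=
  [rel u v | [exists y : oedge,
     [&& y.1 \in sedges T, oorg y == u & oterm y == v]]].

Definition is_connected (T : subgraph) : Prop :=
  (exists v, v \in sverts T) /\
  {in sverts T &, forall u v, connect (sub_adj T) u v}.

(* A closed path without backtracking whose vertices are distinct. *)
Definition is_circuit (T : subgraph) (c : seq oedge) : Prop :=
  [/\ c != [::], all [pred y | y.1 \in sedges T] c,
      cycle [rel y z | (oterm y == oorg z) && (z != orev y)] c
    & uniq (map oorg c)].

Definition is_tree (T : subgraph) : Prop :=
  is_connected T /\ forall c, ~ is_circuit T c.

Definition sub_included (T T' : subgraph) : Prop :=
  sverts T \subset sverts T' /\ sedges T \subset sedges T'.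

Definition is_maximal_tree (T : subgraph) : Prop :=
  is_tree T /\
  forall T', is_tree T' -> sub_included T T' -> sub_included T' T.

End Graph.

Definition connected_graph (Y : graph) : Prop := is_connected (full_subgraph Y).

(* [emb y] is the monomorphism G_y -> G_t(y), a |-> a^y; the equality of the   *)
(* groups of y and of its reverse holds by conversion.                         *)
Record graph_of_groups (Y : graph) := GraphOfGroups {
  vgroup : vert Y -> groupType;
  egroup : edge Y -> groupType;
  emb : forall y : oedge Y, {multiplicative egroup y.1 -> vgroup (oterm y)};
  emb_inj : forall y, injective (emb y)
}.

Section FundamentalGroup.
Context {Y : graph}.
Variables (GG : graph_of_groups Y) (T : subgraph Y).

Definition letter : Type := ({v : vert Y & vgroup GG v} + oedge Y)%type.
HB.instance Definition _ := Choice.on letter.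

Definition vlet (v : vert Y) (g : vgroup GG v) : letter :=
  inl (Tagged (fun v => vgroup GG v) g).
Definition elet (y : oedge Y) : letter := inr y.

(* The congruence on words presenting pi_1: the multiplication tables of the   *)
(* vertex groups, y^-1 = rev y, y a^y y^-1 = a^(rev y), and y = 1 on the tree. *)
Inductive pi1_eq : seq letter -> seq letter -> Prop :=
| pi1_refl w : pi1_eq w w
| pi1_sym w1 w2 : pi1_eq w1 w2 -> pi1_eq w2 w1
| pi1_trans w2 w1 w3 : pi1_eq w1 w2 -> pi1_eq w2 w3 -> pi1_eq w1 w3
| pi1_cat w1 w2 u1 u2 :
    pi1_eq w1 w2 -> pi1_eq u1 u2 -> pi1_eq (w1 ++ u1) (w2 ++ u2)
| pi1_vone v : pi1_eq [:: @vlet v 1%g] [::]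
| pi1_vmul v g h : pi1_eq [:: @vlet v g; @vlet v h] [:: @vlet v (g * h)%g]
| pi1_erev y : pi1_eq [:: elet y; elet (orev y)] [::]
| pi1_edge y (a : egroup GG y.1) :
    pi1_eq [:: elet y; vlet (emb GG y a); elet (orev y)]
           [:: vlet (emb GG (orev y) a)]
| pi1_tree y : y.1 \in sedges T -> pi1_eq [:: elet y] [::].

Definition pi1_rel : rel (seq letter) := [rel w1 w2 | `[< pi1_eq w1 w2 >]].

Let pi1_rel_refl : reflexive pi1_rel.
Proof. by move=> w; apply/asboolP; apply: pi1_refl. Qed.
Let pi1_rel_sym : symmetric pi1_rel.
Proof. by move=> w1 w2; apply/asboolP/asboolP; apply: pi1_sym. Qed.
Let pi1_rel_trans : transitive pi1_rel.
Proof.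
by move=> w2 w1 w3 /asboolP w12 /asboolP w23; apply/asboolP/(pi1_trans w12).
Qed.

Canonical pi1_equiv := EquivRel pi1_rel pi1_rel_refl pi1_rel_sym pi1_rel_trans.

Definition pi1 : Type := {eq_quot pi1_equiv}.
HB.instance Definition _ := Choice.on pi1.
HB.instance Definition _ := EqQuotient.on pi1.

Definition pi1_class (w : seq letter) : pi1 := \pi_pi1 w.

Lemma pi1_classP w1 w2 : pi1_class w1 = pi1_class w2 <-> pi1_eq w1 w2.
Proof. by split=> [/eqmodP/asboolP|?]; last by apply/eqmodP/asboolP. Qed.

Lemma pi1_eq_repr w : pi1_eq (repr (pi1_class w)) w.
Proof. by apply/pi1_classP; rewrite /pi1_class reprK. Qed.

Definition inv_letter (x : letter) : letter :=
  match x with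
  | inl u => vlet (tagged u)^-1%g
  | inr y => elet (orev y)
  end.

Definition inv_word (w : seq letter) : seq letter := rev (map inv_letter w).

Definition pi1_one : pi1 := pi1_class [::].
Definition pi1_mul (p q : pi1) : pi1 := pi1_class (repr p ++ repr q).
Definition pi1_inv (p : pi1) : pi1 := pi1_class (inv_word (repr p)).

Let orevK : involutive (@orev Y).
Proof. by case=> e b; rewrite /orev /= negbK. Qed.

Let inv_letterV x : pi1_eq [:: inv_letter x; x] [::].
Proof.
case: x => [[v g]|y] /=.
  by apply: (pi1_trans (pi1_vmul _ _)); rewrite mulVg; apply: pi1_vone.
by have := pi1_erev (orev y); rewrite orevK.
Qed.

Let inv_letterK x : inv_letter (inv_letter x) = x.
Proof. by case: x => [[v g]|y] /=; rewrite /vlet ?invgK // orevK. Qed.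

Let inv_wordK : involutive inv_word.
Proof.
by move=> w; rewrite /inv_word map_rev revK -map_comp map_id_in // => x _ /=.
Qed.

Let inv_wordV w : pi1_eq (inv_word w ++ w) [::].
Proof.
elim: w => [|x w IHw]; first exact: pi1_refl.
rewrite /inv_word /= rev_cons cat_rcons; apply: pi1_trans IHw.
rewrite -cat1s -[in X in _ ++ X](cat1s x) -/(inv_word w).
apply: pi1_cat; first exact: pi1_refl.
by rewrite catA -[X in pi1_eq _ X]cat0s; apply: pi1_cat;
  [exact: inv_letterV|exact: pi1_refl].
Qed.

Let pi1_mulE w1 w2 : pi1_mul (pi1_class w1) (pi1_class w2) = pi1_class (w1 ++ w2).
Proof. by apply/pi1_classP/pi1_cat; apply: pi1_eq_repr. Qed.

Let pi1_ind_class (P : pi1 -> Prop) : (forall w, P (pi1_class w)) -> forall p, P p.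
Proof. by move=> Pw p; rewrite -(reprK p); apply: Pw. Qed.

Let pi1_mulA : associative pi1_mul.
Proof.
elim/pi1_ind_class=> w1; elim/pi1_ind_class=> w2; elim/pi1_ind_class=> w3.
by rewrite !pi1_mulE catA.
Qed.

Let pi1_mul1 : left_id pi1_one pi1_mul.
Proof. by elim/pi1_ind_class=> w; rewrite pi1_mulE. Qed.

Let pi1_mulr1 : right_id pi1_one pi1_mul.
Proof. by elim/pi1_ind_class=> w; rewrite pi1_mulE cats0. Qed.

Let pi1_mulV : left_inverse pi1_one pi1_inv pi1_mul.
Proof.
move=> p; rewrite /pi1_inv -[X in pi1_mul _ X](reprK p) pi1_mulE.
exact/pi1_classP/inv_wordV.
Qed.

Let pi1_mulrV : right_inverse pi1_one pi1_inv pi1_mul.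
Proof.
move=> p; rewrite /pi1_inv -[X in pi1_mul X _](reprK p) pi1_mulE.
by apply/pi1_classP; rewrite -{1}(inv_wordK (repr p)); apply: inv_wordV.
Qed.

HB.instance Definition _ := @isGroup.Build pi1 pi1_one pi1_inv pi1_mul
  pi1_mulA pi1_mul1 pi1_mulr1 pi1_mulV pi1_mulrV.

Lemma pi1_classM w1 w2 :
  (pi1_class w1 * pi1_class w2)%g = pi1_class (w1 ++ w2).
Proof. exact: pi1_mulE. Qed.

End FundamentalGroup.

Section FiniteGeneration.
Local Open Scope group_scope.
Context {Y : graph}.
Variables (GG : graph_of_groups Y) (T : subgraph Y).
Variable S : forall v, genset (vgroup GG v).

Let vcl v (g : vgroup GG v) : pi1 GG T := pi1_class T [:: vlet g].

Let vcl1 v : vcl (1 : vgroup GG v) = 1.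
Proof. by apply/pi1_classP; apply: pi1_vone. Qed.

Let vclM v (g h : vgroup GG v) : vcl (g * h) = vcl g * vcl h.
Proof. by rewrite pi1_classM; apply/pi1_classP/pi1_sym/pi1_vmul. Qed.

Let vclV v (g : vgroup GG v) : vcl g^-1 = (vcl g)^-1.
Proof. by apply: (@mulgI _ (vcl g)); rewrite -vclM !mulgV vcl1. Qed.

Lemma pi1_finitely_generated : exists S' : {fset pi1 GG T}, generates S'.
Proof.
pose L : seq (pi1 GG T) :=
  [seq pi1_class T [:: elet GG y] | y : oedge Y] ++
  flatten [seq [seq vcl x | x <- enum_fset (S v)] | v <- enum (vert Y)].
exists [fset p in L]%fset; elim/quotW => w; rewrite -/(pi1_class T w).
elim: w => [|x w [u [Su wu]]].
  by exists [::]; split=> //; rewrite big_nil.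
suff [u' [Su' xu']] : exists u', spelled [fset p in L]%fset (pi1_class T [:: x]) u'.
  exists (u' ++ u); split; first by rewrite all_cat Su' Su.
  by rewrite big_cat /= xu' wu pi1_classM.
case: x => [[v g]|y]; last first.
  exists [:: pi1_class T [:: elet GG y]]; split; last by rewrite big_seq1.
  rewrite /= andbT !inE; apply/orP; left; apply/orP; left.
  by apply/fintype.imageP; exists y.
have [s [Ss <-]] := gensP (S v) g.
have LS (x : vgroup GG v) : x \in gens (S v) -> vcl x \in [fset p in L]%fset.
  move=> Sx; rewrite !inE; apply/orP; right; apply/flattenP.
  exists [seq vcl x | x <- enum_fset (S v)]; last exact: map_f.
  by apply/mapP; exists v; rewrite ?mem_enum.
exists [seq vcl x | x <- s]; split.
  rewrite all_map; apply: sub_all Ss => x /= /orP[] /LS Lx.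
    by rewrite Lx.
  by rewrite -vclV Lx orbT.
change (\prod_(x <- map (@vcl v) s) x = vcl (\prod_(x <- s) x)).
by rewrite big_map; elim: {Ss} s => [|x s IHs];
  rewrite ?big_nil ?vcl1 // !big_cons vclM IHs.
Qed.

End FiniteGeneration.

(* The group of y with the word metric of the vertex group at the terminal     *)
(* vertex of y; the group of an edge e can be measured at either end, as       *)
(* [edge_space R S (e, true)] or [edge_space R S (e, false)].                  *)
Definition edge_space (R : realType) {Y : graph} {GG : graph_of_groups Y}
    (S : forall v, genset (vgroup GG v)) (y : oedge Y) : Type :=
  @pullback (egroup GG y.1) (word_space R (S (oterm y))) (emb GG y)
    (@emb_inj Y GG y).

HB.instance Definition _ (R : realType) (Y : graph) (GG : graph_of_groups Y)
    (S : forall v, genset (vgroup GG v)) (y : oedge Y) :=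
  Metric.on (edge_space R S y).

(* Main.v *)
Require Import Defs.
From HB Require Import structures.
From mathcomp Require Import all_boot all_order all_algebra finmap.
From mathcomp Require Import boolp classical_sets cardinality.
From mathcomp Require Import reals constructive_ereal ereal topology.
From mathcomp Require Import zify.

(** The fundamental group acts on the Bass--Serre tree, and the orbit map
    exhibits it, at large scale, as a tree of spaces: one coset of a vertex
    group over each vertex, two adjacent ones touching along a coset of an edge
    group. If the vertex groups have dimension at most n and the edge groups
    dimension at most n - 1, the tree of spaces has dimension at most n, for
    two reasons.

    A ball of the tree carries a space of dimension at most n. By induction on
    the radius, the subtrees hanging from the root have this property. Away
    from a neighbourhood of the vertex space of the root they are far from each
    other, so that their covers fit together after those members which touch
    the root are absorbed into a cover of that neighbourhood
    ([coloured_union], [subtrees_coloured]).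

    The whole space is then cut along walls. A wall is the set of points at a
    given depth beyond an edge of the tree, and the edges used are those whose
    level is a multiple of some large H. The walls are far apart, each lies
    near an edge space, so that n colours suffice for them, and the pieces
    between them involve only boundedly many levels, so that they have covers
    with n + 1 colours. Near a wall the cover of the wall is used; farther away
    its members are merged into members of the cover of the piece, one colour
    after the other. Where colour c is being merged a small ball meets at most
    one set of each other colour and two sets that come from colour c, hence
    n + 1 sets in all ([thin_cover_of_partition]). This is the discrete form of
    a mapping cylinder from the nerve of the wall, which has dimension n - 1,
    to the nerve of the piece.

    The tree of spaces is made of the normal forms
    s_1 y_1 s_2 y_2 ... s_k y_k g, where y_i is an oriented edge, s_i a coset
    representative and g an element of the vertex group reached. The stack
    (s_1, y_1), ..., (s_k, y_k) is a vertex of the tree and k is its level.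
    Vertex group elements and edges act on the right of normal forms by local
    rules; the relations of the fundamental group hold for these rules
    ([act_pi1_eq]), whence vertex groups embed ([vertex_inj]). As balls of the
    fundamental group are finite, the embedding is proper ([vertex_proper]),
    and the space of normal forms has coarsely the metric of the fundamental
    group ([near_alpha], [len_near]). *)

Set Implicit Arguments.
Unset Strict Implicit.
Unset Printing Implicit Defensive.

Import Order.TTheory GRing.Theory Num.Theory.

Local Open Scope classical_set_scope.
Local Open Scope card_scope.
Local Open Scope nat_scope.

(** * Coloured covers *)

(** A metric enters only through the relations [near k x y], that the distance
    of x and y is at most the natural number k. *)
Record coarse {X : Type} (near : nat -> X -> X -> Prop) : Prop := Coarse {
  near0 : forall x, near 0 x x;
  near_sym : forall k x y, near k x y -> near k y x;
  near_trans : forall j k l x y z,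
    near j x y -> near k y z -> j + k <= l -> near l x z
}.

Section Coloured.
Context {X : Type} (near : nat -> X -> X -> Prop).

(** A cover of A by sets of diameter at most D in n colours, two sets of one
    colour being more than r apart. The cover is given by the colour [c x] and
    the name [l x] of a member that contains x. Up to a shift of n by one,
    such covers for all r characterize asymptotic dimension. *)
Definition coloured (A : set X) (n r D : nat) : Prop :=
  exists c : X -> nat, exists l : X -> set X,
  [/\ forall x, A x -> c x < n,
      forall x y, A x -> A y -> c x = c y -> l x = l y -> near D x y
    & forall x y, A x -> A y -> c x = c y -> near r x y -> l x = l y].

(** Names of any type can be replaced by the sets of points that bear them. *)
Lemma colouredI (A : set X) n r D (L : Type) (c : X -> nat) (l : X -> L) :
    (forall x, A x -> c x < n) ->
    (forall x y, A x -> A y -> c x = c y -> l x = l y -> near D x y) ->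
    (forall x y, A x -> A y -> c x = c y -> near r x y -> l x = l y) ->
  coloured A n r D.
Proof.
move=> cn lD lr.
exists c, (fun x => [set y | [/\ A y, c y = c x & l y = l x]]); split=> //.
  move=> x y Ax Ay cxy lxy; apply: lD => //.
  have : [set z | [/\ A z, c z = c x & l z = l x]] x by [].
  by rewrite lxy => -[].
move=> x y Ax Ay cxy /(lr _ _ Ax Ay cxy) lxy.
by apply/seteqP; split=> z [Az cz lz]; split=> //; congruence.
Qed.

Context (nearP : coarse near).

Lemma near_le j k x y : j <= k -> near j x y -> near k x y.
Proof.
by move=> jk xy; apply: (near_trans nearP xy (near0 nearP y)); rewrite addn0.
Qed.

Lemma coloured_le (A : set X) n r D n' r' D' :
  n <= n' -> r' <= r -> D <= D' -> coloured A n r D -> coloured A n' r' D'.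
Proof.
move=> nn rr DD [c [l [cn lD lr]]]; exists c, l; split=> [x Ax|x y Ax Ay cE lE|].
- exact: leq_trans (cn x Ax) nn.
- exact: near_le DD (lD _ _ Ax Ay cE lE).
- by move=> x y Ax Ay cE /(near_le rr); apply: lr.
Qed.

Lemma coloured_sub (A B : set X) n r D :
  B `<=` A -> coloured A n r D -> coloured B n r D.
Proof.
move=> BA [c [l [cn lD lr]]]; exists c, l.
split=> [x /BA|x y /BA + /BA|x y /BA + /BA].
- exact: cn.
- exact: lD.
- exact: lr.
Qed.

End Coloured.

(** Covers travel along coarse embeddings, with other scales and bounds. *)
Lemma coloured_pull X X' (near : nat -> X -> X -> Prop)
    (near' : nat -> X' -> X' -> Prop) (A : set X) (B : set X') (q : X -> X')
    n r D r' D' :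
    (forall x, A x -> B (q x)) ->
    (forall x y, A x -> A y -> near r x y -> near' r' (q x) (q y)) ->
    (forall x y, A x -> A y -> near' D' (q x) (q y) -> near D x y) ->
  coloured near' B n r' D' -> coloured near A n r D.
Proof.
move=> AB qr qD [c [l [cn lD lr]]].
apply: (@colouredI _ _ _ _ _ _ _ (c \o q) (l \o q)) => /=.
- by move=> x /AB/cn.
- by move=> x y Ax Ay cE /(lD _ _ (AB _ Ax) (AB _ Ay) cE); apply: qD.
- by move=> x y Ax Ay cE /(qr _ _ Ax Ay)/(lr _ _ (AB _ Ax) (AB _ Ay) cE).
Qed.

Section Unions.
Context {X : Type} {near : nat -> X -> X -> Prop} (nearP : coarse near).

Lemma coloured_thicken (Y : set X) n r s D :
  coloured near Y n (r + s.*2) D ->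
  coloured near [set x | exists2 y, Y y & near s x y] n r (D + s.*2).
Proof.
move=> Yc.
have /choice[p pP] x : exists p, (exists2 y, Y y & near s x y) -> Y p /\ near s x p.
  have [[y Yy xy]|no] := pselect (exists2 y, Y y & near s x y).
    by exists y.
  by exists x.
apply: (coloured_pull (q := p) _ _ _ Yc) => [x /pP[]//|x y /pP[_ xp] /pP[_ yp] xy|].
  have h := near_trans nearP (near_sym nearP xp) xy (leqnn _).
  by apply: (near_trans nearP h yp); lia.
move=> x y /pP[_ xp] /pP[_ yp] xy.
have h := near_trans nearP xp xy (leqnn _).
by apply: (near_trans nearP h (near_sym nearP yp)); lia.
Qed.

Lemma coloured_family (I : Type) (A : I -> set X) n r D :
  (forall i, coloured near (A i) n r D) ->
  exists c : I -> X -> nat, exists l : I -> X -> set X, forall i,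
  [/\ forall x, A i x -> c i x < n,
      forall x y, A i x -> A i y -> c i x = c i y -> l i x = l i y -> near D x y
    & forall x y, A i x -> A i y -> c i x = c i y -> near r x y -> l i x = l i y].
Proof.
move=> Ac; have [c cP] := choice Ac; have [l lP] := choice cP.
by exists c, l.
Qed.

(** The saturated union. Y is covered at a scale s that exceeds the bound D of
    the covers of the pieces, so that a class of a piece touches at most one
    member of its colour in the cover of Y; it is absorbed by this member. The
    remaining classes of distinct pieces are far apart by assumption. *)
Lemma coloured_union (I : Type) (Y A : set X) (idx : X -> I) n r D s E :
    r.*2 + D <= s ->
    coloured near Y n s E ->
    (forall i, coloured near [set x | [/\ A x, ~ Y x & idx x = i]] n r D) ->
    (forall x y, A x -> A y -> ~ Y x -> ~ Y y -> near r x y -> idx x = idx y) ->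
  coloured near (Y `|` A) n r (E + (r + D).*2).
Proof.
move=> rDs [cY [lY [cYn lYE lYs]]] /coloured_family[cA [lA Ac]] sep.
pose c x := if `[< Y x >] then cY x else cA (idx x) x.
pose cls x := [set z | [/\ A z, ~ Y z, idx z = idx x, c z = c x
                         & lA (idx x) z = lA (idx x) x]].
(* [att x y]: y is a point of Y of the colour of x, touched by the class of x;
if x is in Y, the point x itself *)
pose att x y := [/\ Y y, cY y = c x & if `[< Y x >] then y = x else
   exists2 z, cls x z & near r z y].
have clsD x z : A x -> ~ Y x -> cls x z -> near D x z.
  move=> Ax Yx [Az Yz iz cz lz]; have [_ + _] := Ac (idx x); apply=> //.
  by move: cz; rewrite /c !asboolF // iz.
have cin x : A x -> ~ Y x -> cls x x by [].
have attD x y : (Y `|` A) x -> att x y -> near (r + D) x y.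
  move=> YAx [Yy cy]; case: asboolP => [Yx ->|Yx [z xz zy]].
    exact: (near_le nearP (leq0n _) (near0 nearP x)).
  have Ax : A x by case: YAx.
  by apply: (near_trans nearP (clsD _ _ Ax Yx xz) zy); lia.
have /choice[p pP] x : exists p, (exists y, att x y) -> att x p.
  have [[y xy]|no] := pselect (exists y, att x y); first by exists y.
  by exists x.
pose l x : set X + I * set X :=
  if `[< exists y, att x y >] then inl (lY (p x)) else inr (idx x, lA (idx x) x).
have attY x : Y x -> att x x.
  by move=> Yx; split; rewrite ?/c ?asboolT.
(* p x is a point of the member of the cover of Y that absorbs the class of x;
   as s is large, absorbed classes that touch are absorbed by one member *)
have anchors x y k : c x = c y -> near k (p x) (p y) -> k <= s ->
    (exists z, att x z) -> (exists z, att y z) -> lY (p x) = lY (p y).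
  move=> cxy pxy ks /pP[Ypx cpx _] /pP[Ypy cpy _].
  by apply: lYs; rewrite ?cpx ?cpy //; exact: (near_le nearP ks pxy).
apply: (@colouredI _ _ _ _ _ _ _ c l).
- move=> x [Yx|Ax]; rewrite /c; case: asboolP => // Yx'; first exact: cYn.
    exact: cYn.
  by have [+ _ _] := Ac (idx x); apply.
- move=> x y YAx YAy cxy; rewrite /l.
  case: asboolP => ax; case: asboolP => ay // [].
    move=> lxy; have [Ypx cpx _] := pP _ ax; have [Ypy cpy _] := pP _ ay.
    have pp : near E (p x) (p y) by apply: lYE => //; congruence.
    have h := near_trans nearP (attD _ _ YAx (pP _ ax)) pp (leqnn _).
    apply: (near_trans nearP h (near_sym nearP (attD _ _ YAy (pP _ ay)))).
    by lia.
  move=> ixy lxy.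
  have Yx : ~ Y x by move=> Yx; apply: ax; exists x; apply: attY.
  have Yy : ~ Y y by move=> Yy; apply: ay; exists y; apply: attY.
  have Ax : A x by case: YAx.
  have Ay : A y by case: YAy.
  have xy : cls y x by split=> //; congruence.
  by apply: (near_le nearP _ (near_sym nearP (clsD _ _ Ay Yy xy))); lia.
- suff main x y : (Y `|` A) x -> (Y `|` A) y -> c x = c y -> near r x y ->
      (exists y, att x y) -> l x = l y.
    move=> x y YAx YAy cxy xy.
    have [ax|ax] := pselect (exists y, att x y); first exact: main.
    have [ay|ay] := pselect (exists y', att y y').
      by apply/esym/main => //; apply: near_sym.
    have Yx : ~ Y x by move=> Yx; apply: ax; exists x; apply: attY.
    have Yy : ~ Y y by move=> Yy; apply: ay; exists y; apply: attY.
    have Ax : A x by case: YAx.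
    have Ay : A y by case: YAy.
    have ixy := sep _ _ Ax Ay Yx Yy xy.
    rewrite /l !asboolF //; congr (inr (_, _)) => //.
    rewrite -ixy; have [_ _ +] := Ac (idx x); apply=> //.
    by move: cxy; rewrite /c !asboolF // -ixy.
  move=> YAx YAy cxy xy ax.
  have ay : exists y', att y y'.
    have [Yy|Yy] := pselect (Y y); first by exists y; apply: attY.
    have Ay : A y by case: YAy.
    have [Yx|Yx] := pselect (Y x).
      exists x; split=> //; first by rewrite -cxy /c asboolT.
      rewrite asboolF //; exists y; first exact: cin.
      exact: near_sym.
    have Ax : A x by case: YAx.
    have ixy := sep _ _ Ax Ay Yx Yy xy.
    have lxy : lA (idx y) x = lA (idx y) y.
      rewrite -ixy; have [_ _ +] := Ac (idx x); apply=> //.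
      by move: cxy; rewrite /c !asboolF // -ixy.
    have [z [Yz cz]] := ax; rewrite asboolF // => -[w [Aw Yw iw cw lw] wz].
    exists z; split=> //; first by rewrite -cxy.
    rewrite asboolF //; exists w => //; split=> //; try congruence.
  rewrite /l !asboolT //; congr inl.
  have [Yx|Yx] := pselect (Y x); have [Yy|Yy] := pselect (Y y).
  + have [_ _ ] := pP _ ax; rewrite asboolT // => px.
    have [_ _ ] := pP _ ay; rewrite asboolT // => py.
    by apply: (anchors x y r) => //; rewrite ?px ?py //; lia.
  + have [_ _ ] := pP _ ax; rewrite asboolT // => px.
    apply: (anchors x y (r + (r + D))) => //; last by lia.
    by rewrite px; apply: (near_trans nearP xy (attD _ _ YAy (pP _ ay))).
  + have [_ _ ] := pP _ ay; rewrite asboolT // => py.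
    apply: (anchors x y (r + D + r)) => //; last by lia.
    rewrite py.
    by apply: (near_trans nearP (near_sym nearP (attD _ _ YAx (pP _ ax))) xy).
  have Ax : A x by case: YAx.
  have Ay : A y by case: YAy.
  have ixy := sep _ _ Ax Ay Yx Yy xy.
  have lxy : lA (idx x) x = lA (idx x) y.
    have [_ _ +] := Ac (idx x); apply=> //.
    by move: cxy; rewrite /c !asboolF // -ixy.
  have [_ _ ] := pP _ ax; rewrite asboolF // => -[z [Az Yz iz cz lz] zx].
  have [_ _ ] := pP _ ay; rewrite asboolF // => -[w [Aw Yw iw cw lw] wy].
  have zw : near D z w.
    have [_ + _] := Ac (idx x); apply; [by split|by split; congruence| |congruence].
    by move: cz cw; rewrite /c !asboolF // iz iw -ixy => -> ->;
       move: cxy; rewrite /c !asboolF // -ixy.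
  apply: (anchors x y (r + D + r)) => //; last by lia.
  have h := near_trans nearP (near_sym nearP zx) zw (leqnn _).
  by apply: (near_trans nearP h wy).
Qed.

Lemma coloured_disjoint_union (I : Type) (A : I -> set X) (Z : set X) n r D :
    (forall i, coloured near (A i) n r D) ->
    (forall x, Z x -> exists i, A i x) ->
    (forall i j x y, A i x -> A j y -> near r x y -> i = j) ->
  coloured near Z n r D.
Proof.
move=> /coloured_family[c [l Ac]] ZA sep.
have [[x0 Zx0]|Z0] := pselect (exists x, Z x); last first.
  exists (fun _ => 0), (fun _ => set0); split.
  - by move=> x Zx; case: Z0; exists x.
  - by move=> x y Zx; case: Z0; exists x.
  - by [].
have [i0 _] := ZA _ Zx0.
have /choice[f fP] x : exists i, Z x -> A i x.
  by have [/ZA[i Ai]|nZ] := pselect (Z x); [exists i|exists i0].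
apply: (@colouredI _ _ _ _ _ _ _ (fun x => c (f x) x) (fun x => (f x, l (f x) x))).
- by move=> x /fP; have [+ _ _] := Ac (f x); apply.
- move=> x y /fP Ax /fP Ay cxy [fxy lxy]; rewrite -fxy in Ay cxy lxy.
  by have [_ + _] := Ac (f x); apply.
- move=> x y /fP Ax /fP Ay cxy xy; have fxy := sep _ _ _ _ Ax Ay xy.
  rewrite -fxy in Ay cxy *; congr (_, _).
  by have [_ _ +] := Ac (f x); apply.
Qed.

End Unions.

(** * Gluing covers along the walls of a partition *)

(** A cover of multiplicity at most n: [lab] names the member containing a
    point, and the ball of radius r around x meets only f 0, ..., f n.-1. *)
Definition thin_cover X (near : nat -> X -> X -> Prop) (n r D : nat) : Prop :=
  exists (L : Type) (lab : X -> L),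
    (forall x y, lab x = lab y -> near D x y) /\
    forall x, exists f : nat -> L,
      forall y, near r x y -> exists2 i, i < n & lab y = f i.

Section Partition.
Context {X : Type} {near : nat -> X -> X -> Prop} (nearP : coarse near).
Context {I : Type} (piece : X -> I) (n r : nat).

Definition wall_near (k : nat) : set X :=
  [set x | exists2 y, near k x y & piece y <> piece x].

Lemma wall_near_move j k l x y :
  wall_near k x -> near j x y -> piece y = piece x -> j + k <= l ->
  wall_near l y.
Proof.
move=> [z xz pz] xy pxy jkl; exists z; last by rewrite pxy.
exact: (near_trans nearP (near_sym nearP xy) xz jkl).
Qed.

(** Let the pieces be covered by n + 1 colours, and the collars of the walls
    between them, of width 2r(n + 1), by n colours. A member of colour c of the
    latter cover is kept at distance at most 2r(c + 1) from the wall; beyond,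
    its points in a given piece are handed over to the member of the cover of
    this piece which contains a chosen one of its points there. At most one
    colour changes within a ball of radius r, so that the ball meets at most
    n + 1 sets. Outside the collars the cover of the piece is used. Its scale
    is 2(r + D1), since a point handed over takes the label of a point at
    distance at most D1. *)
Lemma thin_cover_of_partition D1 D2 :
    coloured near (wall_near (r.*2 * n.+1)) n r.*2 D1 ->
    (forall i, coloured near [set x | piece x = i] n.+1 (r + D1).*2 D2) ->
  thin_cover near n.+1 r (D2 + D1.*2).
Proof.
move=> [cZ [lZ [cZn lZD lZr]]] /(coloured_family)[cU [lU UP]].
set Z := wall_near _ in cZn lZD lZr *.
have [[x0 _]|X0] := pselect (exists x : X, True); last first.
  by exists X, id; split=> x; case: X0; exists x.
(* s c is the distance from the wall up to which the colour c is kept; the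
   points where it is kept are called pure *)
pose s c := r.*2 * c.+1.
pose pure x := Z x /\ wall_near (s (cZ x)) x.
have /choice[rep repP] (q : I * nat * set X) : exists z,
    (exists x, [/\ Z x, piece x = q.1.1, cZ x = q.1.2 & lZ x = q.2]) ->
    forall x, [/\ Z x, piece x = q.1.1, cZ x = q.1.2 & lZ x = q.2] ->
    near D1 x z /\ piece z = piece x.
  have [[z [Zz pz cz lz]]|no] := pselect (exists x,
      [/\ Z x, piece x = q.1.1, cZ x = q.1.2 & lZ x = q.2]); last first.
    by exists x0.
  exists z => _ x [Zx px cx lx]; split; last by rewrite px.
  by apply: lZD => //; congruence.
(* the label of x is that of z x in the cover of the piece of x; on a collar,
z x depends only on the piece and the member that contain x *)
pose z x := if `[< Z x >] then rep (piece x, cZ x, lZ x) else x.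
have zP x : near D1 x (z x) /\ piece (z x) = piece x.
  rewrite /z; case: asboolP => [Zx|_].
    by apply: (repP (piece x, cZ x, lZ x)); [exists x|].
  by split=> //; apply: (near_le nearP (leq0n _) (near0 nearP x)).
have zE x y : Z x -> Z y -> piece x = piece y -> cZ x = cZ y -> lZ x = lZ y ->
    z x = z y.
  by move=> Zx Zy pxy cxy lxy; rewrite /z !asboolT // pxy cxy lxy.
pose lab x : (nat * set X) + (I * nat * set X) :=
  if `[< pure x >] then inl (cZ x, lZ x)
  else inr (piece x, cU (piece x) (z x), lU (piece x) (z x)).
exists _, lab; split=> [x y|x].
  rewrite /lab; case: asboolP => px; case: asboolP => py // [].
    move=> cxy lxy; have Dxy : near D1 x y by apply: lZD => //; [case: px|case: py].
    by apply: (near_le nearP _ Dxy); lia.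
  move=> pxy cxy lxy; have [xz pz] := zP x; have [yz pz'] := zP y.
  have zz : near D2 (z x) (z y).
    by have [_ + _] := UP (piece x); apply; rewrite /= ?pz' //; congruence.
  have h := near_trans nearP xz zz (leqnn _).
  by apply: (near_trans nearP h (near_sym nearP yz)); lia.
pose B := [set y | near r x y].
have BB y y' : B y -> B y' -> near r.*2 y y'.
  by move=> xy xy'; apply: (near_trans nearP (near_sym nearP xy) xy'); lia.
have Zl y y' : B y -> B y' -> Z y -> Z y' -> cZ y = cZ y' -> lZ y = lZ y'.
  by move=> By By' Zy Zy' cyy; apply: lZr => //; apply: BB.
have /choice[pk pkP] (Q : set X) : exists y, (exists y', Q y') -> Q y.
  by have [[y Qy]|no] := pselect (exists y, Q y); [exists y|exists x].
have wall_le j k y : j <= k -> wall_near j y -> wall_near k y.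
  by move=> jk [w yw pw]; exists w => //; apply: (near_le nearP jk).
have [[y1 By1 py1]|same] := pselect (exists2 y, B y & piece y <> piece x).
  (* the ball crosses a wall, so that all of it is pure *)
  have Bx : B x by apply: (near_le nearP (leq0n _) (near0 nearP x)).
  have wB y : B y -> wall_near r.*2 y.
    move=> By; have [pyx|pyx] := pselect (piece y = piece x).
      by exists y1; [exact: BB|rewrite pyx].
    by exists x; [exact: BB|move=> e; apply: pyx].
  have ZB y : B y -> Z y by move=> /wB; apply: wall_le; rewrite leq_pmulr.
  have pB y : B y -> pure y.
    move=> By; split; first exact: ZB.
    by apply: wall_le (wB _ By); rewrite leq_pmulr.
  exists (fun i => lab (pk [set y | B y /\ cZ y = i])) => y By.
  exists (cZ y); first exact: ltnW (cZn _ (ZB _ By)).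
  have [Bp cp] := pkP [set y' | B y' /\ cZ y' = cZ y] (ex_intro _ y (conj By erefl)).
  rewrite /lab !asboolT; [|exact: pB..].
  by rewrite cp (Zl _ y Bp By (ZB _ Bp) (ZB _ By)).
have {}same y : B y -> piece y = piece x.
  by move=> By; apply: contrapT => py; apply: same; exists y.
have wmove k y y' : B y -> B y' -> wall_near k y -> wall_near (k + r.*2) y'.
  move=> By By' /wall_near_move; apply; first exact: BB.
    by rewrite !same.
  by rewrite addnC.
have [[y1 By1 Zy1]|allZ] := pselect (exists2 y, B y & ~ Z y).
  (* the ball leaves the collars, so that none of it is pure *)
  have npure y : B y -> ~ pure y.
    move=> By [Zy wy]; apply: Zy1.
    apply: wall_le (wmove _ _ _ By By1 wy).
    by have := cZn _ Zy; rewrite /s; nia.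
  pose W := [set w | exists2 y, B y & w = z y].
  have WW w w' : W w -> W w' -> near (r + D1).*2 w w'.
    move=> [y By ->] [y' By' ->]; have [yz _] := zP y; have [yz' _] := zP y'.
    have h := near_trans nearP (near_sym nearP yz) (BB _ _ By By') (leqnn _).
    by apply: (near_trans nearP h yz'); lia.
  have Wp w : W w -> piece w = piece x.
    by move=> [y By ->]; have [_ ->] := zP y; apply: same.
  pose w i := pk [set w | W w /\ cU (piece x) w = i].
  exists (fun i => inr (piece x, i, lU (piece x) (w i))) => y By.
  have Wzy : W (z y) by exists y.
  have [cn _ lr] := UP (piece x).
  exists (cU (piece x) (z y)); first exact/cn/Wp.
  rewrite /lab asboolF; last exact: npure.
  rewrite same //; congr (inr (_, _, _)).
  have [Ww cw] : W (w (cU (piece x) (z y))) /\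
      cU (piece x) (w (cU (piece x) (z y))) = cU (piece x) (z y).
    exact: (pkP [set w | W w /\ cU (piece x) w = cU (piece x) (z y)]
      (ex_intro _ (z y) (conj Wzy erefl))).
  by apply: lr; [exact: Wp|exact: Wp|rewrite cw|exact: WW].
have {}allZ y : B y -> Z y.
  by move=> By; apply: contrapT => Zy; apply: allZ; exists y.
have labE y y' : B y -> B y' -> cZ y = cZ y' -> (pure y <-> pure y') ->
    lab y = lab y'.
  move=> By By' cyy pyy; have lyy := Zl _ _ By By' (allZ _ By) (allZ _ By') cyy.
  rewrite /lab; case: asboolP => py; case: asboolP => py'; try by exfalso; tauto.
    by rewrite cyy lyy.
  have ->: z y = z y' by apply: zE => //; rewrite ?same //; apply: allZ.
  by rewrite !same.
(* the thresholds s c are 2r apart, and 2r is the diameter of the ball *)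
have one y y' u u' : B y -> B y' -> B u -> B u' -> cZ y = cZ y' -> cZ u = cZ u' ->
    pure y -> ~ pure y' -> pure u -> ~ pure u' -> cZ y = cZ u.
  move=> By By' Bu Bu' cyy cuu [_ wy] py' [_ wu] pu'.
  apply/eqP; rewrite eqn_leq; apply/andP; split; rewrite leqNgt; apply/negP => lt.
    apply: py'; split; first exact: allZ.
    by apply: wall_le (wmove _ _ _ Bu By' wu); rewrite /s -cyy; nia.
  apply: pu'; split; first exact: allZ.
  by apply: wall_le (wmove _ _ _ By Bu' wy); rewrite /s -cuu; nia.
pose g i := pk [set y | B y /\ cZ y = i].
have gP y : B y -> B (g (cZ y)) /\ cZ (g (cZ y)) = cZ y.
  move=> By.
  exact: (pkP [set y' | B y' /\ cZ y' = cZ y] (ex_intro _ y (conj By erefl))).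
pose o := pk [set y | B y /\ lab y <> lab (g (cZ y))].
exists (fun i => if i < n then lab (g i) else lab o) => y By.
have cyn : cZ y < n by apply/cZn/allZ.
have [e|ne] := pselect (lab y = lab (g (cZ y))).
  by exists (cZ y); [exact: ltnW|rewrite cyn].
exists n => //; rewrite ltnn.
have [Bo no] : B o /\ lab o <> lab (g (cZ o)).
  exact: (pkP [set y | B y /\ lab y <> lab (g (cZ y))] (ex_intro _ y (conj By ne))).
have [Bgy cgy] := gP _ By; have [Bgo cgo] := gP _ Bo.
have pny : ~ (pure y <-> pure (g (cZ y))) by move=> /(labE _ _ By Bgy) e; apply/ne/e.
have pno : ~ (pure o <-> pure (g (cZ o))) by move=> /(labE _ _ Bo Bgo) e; apply/no/e.
have flip (P Q : Prop) : ~ (P <-> Q) -> P /\ ~ Q \/ ~ P /\ Q.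
  by have [p|p] := pselect P; have [q|q] := pselect Q; tauto.
have cyo : cZ y = cZ o.
  have [[py pgy]|[py pgy]] := flip _ _ pny; have [[po pgo]|[po pgo]] := flip _ _ pno.
  - exact: (one y (g (cZ y)) o (g (cZ o))).
  - by rewrite -cgo; apply: (one y (g (cZ y)) (g (cZ o)) o).
  - by rewrite -[LHS]cgy; apply: (one (g (cZ y)) y o (g (cZ o))).
  - by rewrite -[LHS]cgy -[RHS]cgo; apply: (one (g (cZ y)) y (g (cZ o)) o).
apply: labE => //; move: pny pno; rewrite cyo.
move: (pure y) (pure o) (pure (g (cZ o))) => P Q G.
by have [p|p] := pselect P; have [q|q] := pselect Q; tauto.
Qed.

End Partition.

(** * Asymptotic dimension through coloured covers *)

Section Metric.
Context {R : realType} (M : metricType R).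

Definition mnear (k : nat) (x y : M) : Prop := (mdist x y <= k%:R)%R.

Lemma mnear_coarse : coarse mnear.
Proof.
split=> [x|k x y|j k l x y z xy yz jkl]; rewrite /mnear.
- by rewrite mdistxx.
- by rewrite metric_sym.
- apply: le_trans (metric_triangle x y z) _.
  apply: (@le_trans _ _ (j%:R + k%:R)%R); first exact: lerD.
  by rewrite -natrD ler_nat.
Qed.

(** From bounded multiplicity to colours. Let S j x be the set of members within
    distance rj of x. These sets increase with j, and have between 1 and n + 1
    elements for j <= n + 1, so that S j x = S j.+1 x for some j <= n. The set
    S j x for this j names a class and its cardinality, less one, is the colour.
    If x and y are r-close and their indices satisfy j <= j', then S j x is
    included in S j'.+1 y = S j' y, with equality if the colours agree. *)
Lemma coloured_of_asdim_le n : asdim_le M n ->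
  forall r, exists D, coloured mnear setT n.+1 r D.
Proof.
move=> Mn r; pose L := r * n.+1.
have L0 : (0 < L.+1%:R :> R)%R by rewrite ltr0n.
have [U [covU [D UD] cardU]] := Mn _ L0.
pose S j x := [set A | U A /\ exists2 a, A a & mnear (r * j) x a].
have SD x j k : j <= k -> S j x `<=` S k x.
  move=> jk A [UA [a Aa xa]]; split=> //; exists a => //.
  by apply: (near_le mnear_coarse _ xa); rewrite leq_mul2l jk orbT.
have S1 x y j : mnear r x y -> S j x `<=` S j.+1 y.
  move=> xy A [UA [a Aa xa]]; split=> //; exists a => //.
  apply: (near_trans mnear_coarse (near_sym mnear_coarse xy) xa).
  by rewrite mulnS.
have cardS x : S n.+1 x #<= `I_n.+1.
  apply: card_le_trans (cardU x); apply: subset_card_le => A [UA [a Aa xa]].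
  split=> //; exists a; split=> //; rewrite ballEmdist /=.
  by apply: le_lt_trans xa _; rewrite ltr_nat.
have finS x j : j <= n.+1 -> finite_set (S j x).
  move=> jn; apply: sub_finite_set (SD x _ _ jn) _.
  by apply/finite_set_leP; exists n.+1.
pose m j x := #|` fset_set (S j x)|.
have m_mono x j k : j <= k -> k <= n.+1 -> m j x <= m k x.
  move=> jk kn; apply: fsubset_leq_card.
  by rewrite -fset_set_sub; [exact: SD|exact/finS/(leq_trans jk)|exact: finS].
have m0 x : 0 < m 0 x.
  have [A UA Ax] : (\bigcup_(A in U) A) x by rewrite covU.
  rewrite cardfs_gt0; apply/fset0Pn; exists A; rewrite in_fset_set; last exact: finS.
  rewrite inE; split=> //; exists x => //.
  exact: (near_le mnear_coarse (leq0n _) (near0 mnear_coarse x)).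
have mn x : m n.+1 x <= n.+1 by apply: geq_card_fset_set.
have Seq x y j k : j <= n.+1 -> k <= n.+1 -> S j x `<=` S k y -> m j x = m k y ->
    S j x = S k y.
  move=> jn kn sub mjk.
  suff e : fset_set (S j x) = fset_set (S k y).
    by rewrite -(fset_setK (finS x _ jn)) e fset_setK //; apply: finS.
  apply/eqP.
  rewrite eqEfcard -/(m _ _) -/(m _ _) mjk leqnn andbT.
  by rewrite -fset_set_sub; [|exact: finS..].
have /choice[j jP] x : exists j, j <= n /\ m j x = m j.+1 x.
  apply: contrapT => nj.
  suff lt j : j <= n.+1 -> j < m j x by have := lt _ (leqnn n.+1); have := mn x; lia.
  elim: j => [|j IHj] jn; first exact: m0.
  have := m_mono x _ _ (leqnSn j) jn; rewrite leq_eqVlt => /orP[/eqP e|].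
    by case: nj; exists j.
  by apply: leq_trans; rewrite ltnS IHj // ltnW.
have mle x k : k <= n.+1 -> m k x <= n.+1.
  by move=> kn; apply: leq_trans (mn x); apply: m_mono.
pose K := Num.truncn `|D|%R.
have DK : (D <= K.+1%:R)%R.
  by apply: le_trans (ler_norm _) _; apply/ltW/truncnS_gt.
exists (L + K.+1 + L).
apply: (@colouredI _ _ _ _ _ _ _ (fun x => (m (j x) x).-1) (fun x => S (j x) x)).
- move=> x _; have [jn _] := jP x.
  by have := mle x (j x) (leqW jn); lia.
- move=> x y _ _ _ Sxy; have [jxn _] := jP x; have [jyn _] := jP y.
  have [A UA Ax] : (\bigcup_(A in U) A) x by rewrite covU.
  have SA : S (j x) x A.
    split=> //; exists x => //.
    exact: (near_le mnear_coarse (leq0n _) (near0 mnear_coarse x)).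
  move: (SA); rewrite Sxy => -[_ [a Aa ya]].
  have xa : mnear K.+1 x a by apply: le_trans DK; apply: UD UA _ _ Ax Aa.
  apply: (near_trans mnear_coarse xa (near_sym mnear_coarse ya)).
  have : r * j y <= L by rewrite leq_mul2l (leqW jyn) orbT.
  by lia.
- suff main x y : j x <= j y -> m (j x) x = m (j y) y -> mnear r x y ->
      S (j x) x = S (j y) y.
    move=> x y _ _ mxy xy.
    have mm : m (j x) x = m (j y) y.
      have [jxn _] := jP x; have [jyn _] := jP y.
      have := m_mono x 0 (j x) (leq0n _) (leqW jxn).
      have := m_mono y 0 (j y) (leq0n _) (leqW jyn).
      by have := m0 x; have := m0 y; lia.
    have [jxy|/ltnW jyx] := leqP (j x) (j y); first exact: main.
    by apply/esym/main => //; exact: (near_sym mnear_coarse xy).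
  move=> jxy mxy xy; have [jxn mx] := jP x; have [jyn my] := jP y.
  have Syy : S (j y) y = S (j y).+1 y.
    by apply: Seq => //; [exact: leqW|exact: SD].
  apply: Seq mxy; [exact: leqW..|rewrite Syy].
  by apply: subset_trans (S1 x y (j x) xy) _; exact: SD.
Qed.

Lemma asdim_le_of_thin_cover n :
  (forall r, exists D, thin_cover mnear n.+1 r D) -> asdim_le M n.
Proof.
move=> cov r r0; have [D [L [lab [labD labn]]]] := cov (Num.bound r).
exists [set A | exists x, A = [set y | lab y = lab x]]; split.
- rewrite -subTset => x _.
  by exists [set y | lab y = lab x] => //; exists x.
- exists D%:R%R => _ [z ->] x y /= xz yz; apply: labD; congruence.
- move=> x; have [f fP] := labn x.
  apply: card_le_trans (card_image_le (fun i => [set y | lab y = f i]) `I_n.+1).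
  apply: subset_card_le => _ [[z ->] [y [/= yz xy]]].
  have [|i ilt yi] := fP y.
    move: xy; rewrite ballEmdist /= => /ltW/le_trans; apply.
    exact/ltW/archi_boundP/ltW.
  by exists i => //; apply/seteqP; split=> w /=; congruence.
Qed.

End Metric.

(** * Walks in a maximal tree *)

Section Walks.
Context {Y : graph}.
Implicit Types (u v w : vert Y) (y z : oedge Y) (p q : seq (oedge Y)).

Lemma orevK : involutive (@orev Y).
Proof. by case=> e b; rewrite /orev /= negbK. Qed.

Lemma orev_neq y : orev y != y.
Proof. by case: y => e b; rewrite /orev xpair_eqE eqxx; case: b. Qed.

Lemma oterm_orev y : oterm (orev y) = oorg y. Proof. by []. Qed.

Lemma oedge_cases y z : y.1 = z.1 -> y = z \/ y = orev z.
Proof.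
by case: y z => [e b] [e' b'] /= ->; rewrite /orev /=; case: b b' => [] []; auto.
Qed.

Lemma oorg_orev y : oorg (orev y) = oterm y.
Proof. by rewrite /oorg orevK. Qed.

Fixpoint walk u p v :=
  if p is y :: p' then (oorg y == u) && walk (oterm y) p' v else u == v.

Lemma walk_cat u p q w : walk u (p ++ q) w <-> exists2 v, walk u p v & walk v q w.
Proof.
elim: p u => [|y p IHp] u /=.
  by split=> [uq|[v /eqP->]//]; exists u => //; rewrite eqxx.
split=> [/andP[yu /IHp[v pv vq]]|[v /andP[yu pv] vq]].
  by exists v => //; rewrite yu.
by rewrite yu; apply/IHp; exists v.
Qed.

Definition rev_walk p := rev (map (@orev Y) p).

Lemma rev_walk_cons y p : rev_walk (y :: p) = rev_walk p ++ [:: orev y].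
Proof. by rewrite /rev_walk /= rev_cons cats1. Qed.

Lemma walk_rev u p v : walk u p v -> walk v (rev_walk p) u.
Proof.
elim: p u => [|y p IHp] u /=; first by move/eqP->.
move=> /andP[/eqP yu /IHp yv]; rewrite rev_walk_cons; apply/walk_cat.
by exists (oterm y) => //=; rewrite oorg_orev oterm_orev yu !eqxx.
Qed.

Definition in_tree (T : subgraph Y) p := all [pred y | y.1 \in sedges T] p.

Lemma in_tree_rev T p : in_tree T (rev_walk p) = in_tree T p.
Proof. by rewrite /in_tree /rev_walk all_rev all_map. Qed.

Definition no_backtrack p := sorted [rel y z | z != orev y] p.

Lemma split_repeat (A B : eqType) (f : A -> B) (s : seq A) : ~~ uniq (map f s) ->
  exists s1 a s2 b s3, s = s1 ++ (a :: s2) ++ b :: s3 /\ f a = f b.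
Proof.
elim: s => [//|a s IHs] /=; rewrite negb_and negbK => /orP[/mapP[b bs fab]|].
  by case/splitPr: bs => s2 s3; exists [::], a, s2, b, s3.
move=> /IHs[s1 [b [s2 [c [s3 [-> fbc]]]]]].
by exists (a :: s1), b, s2, c, s3.
Qed.

Lemma walk_path u y p v : walk u (y :: p) v -> no_backtrack (y :: p) ->
  path [rel y z | (oterm y == oorg z) && (z != orev y)] y p /\
  oterm (last y p) = v.
Proof.
elim: p u y => [|z p IHp] u y /=; first by move=> /andP[_ /eqP].
move=> /and3P[_ zy pv] /andP[zy' nb]; rewrite eq_sym zy zy' /=.
by apply: (IHp (oterm y)) => //=; rewrite zy.
Qed.

(** A shortest counterexample visits no vertex twice, otherwise it contains a
    shorter one. As it is not a circuit, it backtracks when closing up, and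
    removing both end edges leaves a closed walk without backtracks, which is
    empty by minimality: the walk itself was a backtrack. *)
Lemma no_backtrack_closed (T : subgraph Y) u p : (forall c, ~ is_circuit T c) ->
  walk u p u -> in_tree T p -> no_backtrack p -> p = [::].
Proof.
move=> noc; have [k] := ubnP (size p); elim: k => // k IHk in u p *.
rewrite ltnS => pk pu pT nb; case: p => [//|y q] in pk pu pT nb *.
have [un|/split_repeat[s1 [x [s2 [z [s3 [yq xz]]]]]]] :=
  boolP (uniq (map (@oorg Y) (y :: q))).
  (* the origins are distinct, so the walk backtracks where it closes up *)
  exfalso; have [yqp lu] := walk_path pu nb; have [uy _] := andP pu.
  apply: (noc (y :: q)); split=> //=.
  rewrite rcons_path yqp /= lu (eqP uy) eqxx /=; apply/eqP => ylast.
  case/lastP: q => [|q z] in pk pu pT nb yqp un ylast lu *.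
    by have := orev_neq y; rewrite [in orev y]ylast /= orevK eqxx.
  rewrite last_rcons in ylast lu; rewrite -cats1 in pk pu pT nb.
  have {}pu : walk (oterm y) q (oterm y).
    move: pu => /= /andP[_ /walk_cat[v qv /= /andP[/eqP zv _]]].
    by move: qv; rewrite -zv ylast oterm_orev.
  have qT : in_tree T q by move: pT; rewrite /in_tree /= all_cat => /and3P[].
  have nbq : no_backtrack q.
    by move: nb; rewrite /no_backtrack -cat1s => /cat_sorted2[_ /cat_sorted2[]].
  have q0 : q = [::].
    by apply: (IHk _ _ _ pu qT nbq); move: pk; rewrite /= size_cat /=; lia.
  by move: nb; rewrite q0 /= ylast orevK eqxx.
(* the part of the walk between two visits of one vertex is closed *)
exfalso; rewrite yq in pk pu pT nb.
have [v _ /walk_cat[w vw /= /andP[/eqP zw _]]] := (walk_cat _ _ _ _).1 pu.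
have xv : oorg x = v by move: vw => /= /andP[/eqP].
have vw' : walk v (x :: s2) v by rewrite -[X in walk _ _ X]xv xz zw.
have xT : in_tree T (x :: s2).
  by move: pT; rewrite /in_tree !all_cat => /and3P[].
have nbx : no_backtrack (x :: s2).
  by move: nb; rewrite /no_backtrack => /cat_sorted2[_ /cat_sorted2[]].
suff : x :: s2 = [::] by [].
by apply: (IHk _ _ _ vw' xT nbx); move: pk; rewrite !size_cat /=; lia.
Qed.

(** Closed walks in a tree reduce to the empty walk by deletion of backtracks. *)
Lemma tree_walk_closed (Q : seq (oedge Y) -> Prop) (T : subgraph Y) :
    (forall c, ~ is_circuit T c) -> Q [::] ->
    (forall p y q, Q (p ++ q) -> Q (p ++ [:: y, orev y & q])) ->
  forall u p, walk u p u -> in_tree T p -> Q p.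
Proof.
move=> noc Q0 Qback u p; have [k] := ubnP (size p).
elim: k => // k IHk in p *; rewrite ltnS => pk pu pT.
have [nb|] := boolP (no_backtrack p).
  by rewrite (no_backtrack_closed noc pu pT nb).
have split_bt s : ~~ no_backtrack s -> exists s1 y s2, s = s1 ++ [:: y, orev y & s2].
  elim: s => [//|y [//|z s] IHs]; rewrite /no_backtrack /= negb_and negbK.
  case/orP=> [/eqP->|/IHs[s1 [x [s2 ->]]]]; first by exists [::], y, s.
  by exists (y :: s1), x, s2.
move=> /split_bt[s1 [y [s2 ps]]]; rewrite ps in pk pu pT *.
apply: Qback; apply: IHk.
- by move: pk; rewrite !size_cat /=; lia.
- have [v uv /= /and3P[/eqP yv _ vu]] := (walk_cat _ _ _ _).1 pu.
  by apply/walk_cat; exists v => //; rewrite -yv -oterm_orev.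
- by move: pT; rewrite /in_tree !all_cat /= => /and4P[-> _ _ ->].
Qed.

Lemma tree_walk (T : subgraph Y) u v : is_connected T ->
  u \in sverts T -> v \in sverts T -> exists2 p, walk u p v & in_tree T p.
Proof.
move=> [_ conn] uT vT; have /connectP[s us ->] := conn u v uT vT.
elim: s u us {uT} => [|w s IHs] u /=; first by exists [::] => //=; rewrite eqxx.
move=> /andP[/existsP[y /and3P[yT /eqP yu /eqP yw]] /IHs[p wp pT]].
by exists (y :: p) => /=; rewrite ?yu ?yw ?eqxx ?yT.
Qed.

Lemma sub_adj_sym (T : subgraph Y) : symmetric (sub_adj T).
Proof.
suff h u v : sub_adj T u v -> sub_adj T v u by move=> u v; apply/idP/idP => /h.
move=> /existsP[y /and3P[yT yu yv]]; apply/existsP; exists (orev y).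
by rewrite yT oorg_orev yu yv.
Qed.

(** Otherwise an edge leaving the tree can be added to it: its far end is a
    leaf, through which no circuit can pass without backtracking. *)
Lemma maximal_tree_spanning (T : subgraph Y) : connected_graph Y ->
  is_maximal_tree T -> forall v, v \in sverts T.
Proof.
move=> [_ conn] [[[[v0 v0T] Tconn] noc] Tmax] v.
apply: contrapT => /negP vT.
have /connectP[s us vlast] := conn v0 v (finset.in_setT _) (finset.in_setT _).
have [y yT yT'] : exists2 y : oedge Y, oorg y \in sverts T & oterm y \notin sverts T.
  elim: s v0 v0T us vlast {Tconn} => [|w s IHs] u uT /=.
    by move=> _ e; rewrite e uT in vT.
  move=> /andP[/existsP[y /and3P[_ /eqP yu /eqP yw]] ws] vlast.
  have [wT|wT] := boolP (w \in sverts T); first exact: IHs ws vlast.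
  by exists y; rewrite ?yu ?yw.
set w := oterm y in yT'.
have ends (z : oedge Y) : z.1 \in finset.setU [set y.1]%SET (sedges T) ->
    oterm z \in finset.setU [set w]%SET (sverts T).
  rewrite finset.in_setU finset.in_set1.
  case/orP=> [/eqP/oedge_cases[->|->]|/sub_ends zT].
      by rewrite finset.in_setU finset.in_set1 eqxx.
    by rewrite finset.in_setU oterm_orev yT orbT.
  by rewrite finset.in_setU zT orbT.
pose T' := Subgraph ends.
have T'adj : subrel (connect (sub_adj T)) (connect (sub_adj T')).
  apply: connect_sub => a b /existsP[z /and3P[zT za zb]]; apply: connect1.
  by apply/existsP; exists z; rewrite finset.in_setU zT orbT za zb.
have yadj : sub_adj T' (oorg y) w.
  by apply/existsP; exists y; rewrite finset.in_setU finset.in_set1 !eqxx.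
have T'0 a : a \in sverts T' -> connect (sub_adj T') v0 a.
  rewrite finset.in_setU finset.in_set1 => /orP[/eqP->|aT].
    by apply: connect_trans (connect1 yadj); apply/T'adj/Tconn.
  by apply/T'adj/Tconn.
have T'tree : is_tree T'.
  split; first split.
  - by exists v0; rewrite finset.in_setU v0T orbT.
  - move=> a b /T'0 v0a /T'0 v0b; apply: connect_trans v0b.
    by rewrite (sym_connect_sym (sub_adj_sym T')).
  - move=> c [c0 cT' cyc un].
    have atw (z : oedge Y) : z.1 \in sedges T' -> oterm z = w -> z = y.
      rewrite finset.in_setU finset.in_set1.
      case/orP=> [/eqP/oedge_cases[//|zr] zw|/sub_ends + zw].
        by move: yT; rewrite -oterm_orev -zr zw (negbTE yT').
      by rewrite zw (negbTE yT').
    have nw z : z \in c -> oterm z != w.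
      move=> zc; apply/eqP => zw; have zT := allP cT' _ zc.
      have := next_cycle cyc zc; set z' := next c z => /= /andP[/eqP zz' nzz'].
      have z'c : z' \in c by rewrite mem_next.
      have := atw (orev z') (allP cT' _ z'c); rewrite oterm_orev -zz' => /(_ zw) z'y.
      by move: nzz'; rewrite (atw _ zT zw) -z'y orevK eqxx.
    have nw' z : z \in c -> oorg z != w.
      move=> zc; have := prev_cycle cyc zc => /= /andP[/eqP <- _].
      by apply: nw; rewrite mem_prev.
    apply: (noc c); split=> //; apply/allP => z zc /=.
    have := allP cT' _ zc; rewrite /= finset.in_setU finset.in_set1.
    case/orP=> [/eqP/oedge_cases[zE|zE]|//].
    + by have := nw _ zc; rewrite zE eqxx.
    + by have := nw' _ zc; rewrite zE oorg_orev eqxx.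
have [|sub _] := Tmax T' T'tree.
  by split; apply: finset.subsetUr.
have := fintype.subsetP sub w.
rewrite finset.in_setU finset.in_set1 eqxx => /(_ isT).
by rewrite (negbTE yT').
Qed.

End Walks.

(** * Normal forms *)

Section VertexProduct.
Local Open Scope group_scope.
Context {Y : graph} (GG : graph_of_groups Y).

(** Elements of the various vertex groups are handled as elements of one group,
    the product of the vertex groups; this avoids casts along equalities of
    vertices in the combinatorics of words. *)
Definition vprod : Type := forall v, vgroup GG v.

HB.instance Definition _ := Choice.on vprod.

Let mul (p q : vprod) : vprod := fun v => p v * q v.
Let inv (p : vprod) : vprod := fun v => (p v)^-1.
Let one : vprod := fun _ => 1.

Let mulA : associative mul.
Proof. by move=> p q r; apply: functional_extensionality_dep => v; apply: mulgA. Qed.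
Let mul1 : left_id one mul.
Proof. by move=> p; apply: functional_extensionality_dep => v; apply: mul1g. Qed.
Let mulr1 : right_id one mul.
Proof. by move=> p; apply: functional_extensionality_dep => v; apply: mulg1. Qed.
Let mulV : left_inverse one inv mul.
Proof. by move=> p; apply: functional_extensionality_dep => v; apply: mulVg. Qed.
Let mulrV : right_inverse one inv mul.
Proof. by move=> p; apply: functional_extensionality_dep => v; apply: mulgV. Qed.

HB.instance Definition _ := @isGroup.Build vprod one inv mul
  mulA mul1 mulr1 mulV mulrV.

Definition vinj v (h : vgroup GG v) : vprod := dfwith (fun _ => 1) h.

Lemma vinjE v (h : vgroup GG v) : vinj h v = h.
Proof. exact: dfwith_in. Qed.

Lemma vinj_inj v : injective (@vinj v).
Proof. by move=> h k /(congr1 (fun p : vprod => p v)); rewrite !vinjE. Qed.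

Lemma vinjM v : {morph @vinj v : h k / h * k}.
Proof.
move=> h k; apply: functional_extensionality_dep => u.
have [<-|vu] := eqVneq v u; first by rewrite -[RHS]/(_ * _) !vinjE.
by rewrite -[RHS]/(vinj h u * vinj k u) /vinj !dfwith_out // mulg1.
Qed.

Lemma vinj1 v : vinj (1 : vgroup GG v) = 1.
Proof. by apply: (@mulgI _ (vinj (1 : vgroup GG v))); rewrite -vinjM !mulg1. Qed.

Lemma vinjV v : {morph @vinj v : h / h^-1}.
Proof. by move=> h; apply: (@mulgI _ (vinj h)); rewrite -vinjM !mulgV vinj1. Qed.

Definition einj (y : oedge Y) (a : egroup GG y.1) : vprod := vinj (emb GG y a).

Lemma einjM y : {morph @einj y : a b / a * b}.
Proof. by move=> a b; rewrite /einj gmulfM vinjM. Qed.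

Lemma einj_inj y : injective (@einj y).
Proof. by move=> a b /vinj_inj/emb_inj. Qed.

Lemma einj1 y : einj (1 : egroup GG y.1) = 1.
Proof. by apply: (@mulgI _ (einj (1 : egroup GG y.1))); rewrite -einjM !mulg1. Qed.

Lemma einjV y : {morph @einj y : a / a^-1}.
Proof. by move=> a; apply: (@mulgI _ (einj a)); rewrite -einjM !mulgV einj1. Qed.

Definition at_vertex v (p : vprod) : Prop := exists h : vgroup GG v, p = vinj h.

Lemma at_vertexM v p q : at_vertex v p -> at_vertex v q -> at_vertex v (p * q).
Proof. by move=> [h ->] [k ->]; exists (h * k); rewrite vinjM. Qed.

Lemma at_vertex1 v : at_vertex v 1.
Proof. by exists 1; rewrite vinj1. Qed.

Lemma at_einj (y : oedge Y) (a : egroup GG y.1) : at_vertex (oterm y) (einj a).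
Proof. by exists (emb GG y a). Qed.

Lemma at_einj_rev (y : oedge Y) (a : egroup GG y.1) :
  at_vertex (oorg y) (@einj (orev y) a).
Proof. by exists (emb GG (orev y) a). Qed.

(** Representatives of the left cosets of the edge group of y, seen at the
    origin of y; the trivial coset is represented by 1, as reduced words
    require. *)
Definition coset_rep (y : oedge Y) (p : vprod) : vprod :=
  if `[< exists a, p = @einj (orev y) a >] then 1
  else xget 1 [set q | exists a, q = p * @einj (orev y) a].

Lemma coset_repP y p : exists a : egroup GG y.1,
  p = coset_rep y p * @einj (orev y) a.
Proof.
rewrite /coset_rep; case: asboolP => [[a pa]|_].
  by exists a; rewrite mul1g.
have [a ->] : [set q | exists a, q = p * @einj (orev y) a]
    (xget 1 [set q | exists a, q = p * @einj (orev y) a]).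
  apply: (@xgetPex _ 1 [set q | exists a, q = p * @einj (orev y) a]).
  by exists p, 1; rewrite einj1 mulg1.
by exists a^-1; rewrite einjV mulgK.
Qed.

Definition coset_arg (y : oedge Y) (p : vprod) : egroup GG y.1 :=
  xget 1 [set a | p = coset_rep y p * @einj (orev y) a].

Lemma coset_argP y p : p = coset_rep y p * @einj (orev y) (coset_arg y p).
Proof.
exact: (@xgetPex _ 1 [set a | p = coset_rep y p * @einj (orev y) a]
  (coset_repP y p)).
Qed.

Lemma coset_repM y p (a : egroup GG y.1) :
  coset_rep y (p * @einj (orev y) a) = coset_rep y p.
Proof.
rewrite /coset_rep.
have -> : `[< exists b, p * @einj (orev y) a = @einj (orev y) b >] =
          `[< exists b, p = @einj (orev y) b >].
  apply/asbool_equiv_eq; split=> -[b pb].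
    by exists (b * a^-1); rewrite einjM einjV -pb mulgK.
  by exists (b * a); rewrite einjM pb.
suff -> : [set q | exists b, q = p * @einj (orev y) a * @einj (orev y) b] =
          [set q | exists b, q = p * @einj (orev y) b] by [].
apply/seteqP; split=> q [b ->].
  by exists (a * b); rewrite einjM mulgA.
by exists (a^-1 * b); rewrite einjM einjV -!mulgA mulVKg.
Qed.

Lemma coset_argM y p (a : egroup GG y.1) :
  coset_arg y (p * @einj (orev y) a) = coset_arg y p * a.
Proof.
apply: (@einj_inj (orev y)); apply: (@mulgI _ (coset_rep y p)).
rewrite -{1}(coset_repM p a) -coset_argP einjM mulgA.
by congr (_ * _); apply: coset_argP.
Qed.

Lemma coset_rep_einj y (a : egroup GG y.1) : coset_rep y (@einj (orev y) a) = 1.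
Proof. by rewrite /coset_rep asboolT //; exists a. Qed.

Lemma coset_arg_einj y (a : egroup GG y.1) : coset_arg y (@einj (orev y) a) = a.
Proof.
apply: (@einj_inj (orev y)).
by rewrite [RHS](coset_argP y) coset_rep_einj mul1g.
Qed.

Lemma coset_repE y p :
  coset_rep y p = p * @einj (orev y) (coset_arg y p)^-1.
Proof. by rewrite einjV; apply/(canRL (mulgK _))/esym/coset_argP. Qed.

Lemma coset_rep_id y p : coset_rep y (coset_rep y p) = coset_rep y p.
Proof. by rewrite [in LHS](coset_repE y p) coset_repM. Qed.

Lemma at_coset_rep y p : at_vertex (oorg y) p -> at_vertex (oorg y) (coset_rep y p).
Proof. by move=> pv; rewrite coset_repE; apply: at_vertexM pv (at_einj_rev _). Qed.

End VertexProduct.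

Section StackMachine.
Local Open Scope group_scope.
Context {Y : graph} (GG : graph_of_groups Y) (v0 : vert Y).
Local Notation P := (vprod GG).

(** A normal form s_1 y_1 ... s_k y_k g, with the pair of the last edge y_k and
    of s_k at the head of the list. *)
Definition state : Type := (seq (oedge Y * P) * P)%type.
Implicit Types (x : state) (y z : oedge Y) (stk : seq (oedge Y * P)).

Definition top stk : vert Y := if stk is (y, _) :: _ then oterm y else v0.

(** The word is a path of the graph from v0, the s_i are the chosen coset
    representatives, and the word is reduced: no y 1 y^-1 occurs. *)
Fixpoint normal stk : Prop :=
  if stk is (y, s) :: stk' then
    [/\ oorg y = top stk', at_vertex (oorg y) s, coset_rep y s = s,
        (if stk' is (z, _) :: _ then y = orev z -> s <> 1 else True)
      & normal stk']
  else True.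

Definition at_state v x : Prop :=
  [/\ normal x.1, top x.1 = v & at_vertex v x.2].

(** Right multiplication by the edge y. Write the last entry as s a, where s is
    the representative of its coset and a comes from the edge group; then
    s a y = s y a', where a' is the image of a at the end of y. If s = 1
    and the last edge is the reverse of y, then y cancels it; otherwise y is
    appended to the word. *)
Definition step y x : state :=
  if x.1 is (z, s) :: stk then
    if (z == orev y) && (coset_rep y x.2 == 1)
    then (stk, s * einj (coset_arg y x.2))
    else ((y, coset_rep y x.2) :: x.1, einj (coset_arg y x.2))
  else ([:: (y, coset_rep y x.2)], einj (coset_arg y x.2)).

Definition right_mul p x : state := (x.1, x.2 * p).

Definition base_state : state := ([::], 1).

Lemma at_base : at_state v0 base_state.
Proof. by split=> //; apply: at_vertex1. Qed.

Lemma at_right_mul v x (h : vgroup GG v) :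
  at_state v x -> at_state v (right_mul (vinj h) x).
Proof. by case=> nx tx px; split=> //=; apply: at_vertexM px _; exists h. Qed.

Lemma right_mulM v x (h k : vgroup GG v) :
  right_mul (vinj k) (right_mul (vinj h) x) = right_mul (vinj (h * k)) x.
Proof. by rewrite /right_mul /= vinjM mulgA. Qed.

Lemma right_mul1 v x : right_mul (vinj (1 : vgroup GG v)) x = x.
Proof. by case: x => stk p; rewrite /right_mul vinj1 mulg1. Qed.

Variant step_spec y x : state -> Prop :=
| StepPop z s stk of x.1 = (z, s) :: stk & z = orev y & coset_rep y x.2 = 1 :
    step_spec y x (stk, s * einj (coset_arg y x.2))
| StepPush of (if x.1 is (z, _) :: _ then z = orev y -> coset_rep y x.2 <> 1
               else True) :
    step_spec y x ((y, coset_rep y x.2) :: x.1, einj (coset_arg y x.2)).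

Lemma stepP y x : step_spec y x (step y x).
Proof.
rewrite /step; case xE : x.1 => [|[z s] stk].
  by rewrite -[in X in step_spec _ _ X]xE; constructor; rewrite xE.
case: ifP => [/andP[/eqP zy /eqP r1]|/negbT].
  exact: StepPop xE zy r1.
rewrite negb_and => zr; rewrite -xE; apply: StepPush; rewrite xE.
by move=> zy r1; move: zr; rewrite zy r1 !eqxx.
Qed.

Lemma at_step y x : at_state (oorg y) x -> at_state (oterm y) (step y x).
Proof.
move=> [nx tx px]; case: (stepP y x) => [z s stk xE zy _|push].
  move: nx; rewrite xE /= => -[zt zs _ _ ns]; split=> //=.
    by rewrite -zt zy oorg_orev.
  move: zs; rewrite zy oorg_orev => zs.
  exact: at_vertexM zs (at_einj _).
split=> //=; last exact: at_einj.
split=> //; first exact: at_coset_rep.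
  exact: coset_rep_id.
by move: push; case: (x.1) => [//|[z s] stk] push yz; apply: push; rewrite yz orevK.
Qed.

(** Normality makes steps invertible: appending is undone by cancelling as the
    trivial coset is represented by 1, and cancelling is undone by appending as
    the word is reduced and s_k is its own representative. *)
Lemma step_rev y x : at_state (oorg y) x -> step (orev y) (step y x) = x.
Proof.
have einjK (a : egroup GG y.1) : einj a = @einj _ GG (orev (orev y)) a.
  by case: y a => e b a; rewrite /einj /orev /= negbK.
have repK (a : egroup GG y.1) : coset_rep (orev y) (einj a) = 1.
  by rewrite einjK coset_rep_einj.
have argK (a : egroup GG y.1) : coset_arg (orev y) (einj a) = a.
  by rewrite einjK coset_arg_einj.
move=> [nx tx px]; case: (stepP y x) => [z s stk xE zy r1|push].
  move: nx; rewrite xE /= => -[zt zs zr zn ns].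
  have rs : coset_rep (orev y) (s * einj (coset_arg y x.2)) = s.
    by rewrite einjK coset_repM -zy.
  have as_ : coset_arg (orev y) (s * einj (coset_arg y x.2)) = coset_arg y x.2.
    rewrite einjK coset_argM; suff -> : coset_arg (orev y) s = 1 by rewrite mul1g.
    apply: (@einj_inj _ _ (orev (orev y))); rewrite einj1; apply: (@mulgI _ s).
    have s_rep : coset_rep (orev y) s = s by rewrite -zy.
    by rewrite mulg1 [RHS](coset_argP (orev y)) s_rep.
  have xs : x.2 = einj (coset_arg y x.2 : egroup GG (orev y).1).
    by rewrite [LHS](coset_argP y) r1 mul1g.
  rewrite /step /= rs as_ -xs.
  suff push : (if stk is (z', _) :: _ then z' = orev (orev y) -> s <> 1 else True).
    case: stk xE zt zn ns push => [|[z' s'] stk] xE zt zn ns push.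
      by rewrite -zy -xE; case: (x).
    case: ifP => [/andP[/eqP z'y /eqP s1]|_]; first by have := push z'y s1.
    by rewrite -zy -xE; case: (x).
  by move: zn; case: (stk) => [//|[z' s'] _] zn z'y; apply: zn; rewrite z'y orevK.
rewrite /step /= orevK eqxx repK eqxx /= argK.
by rewrite -coset_argP; case: (x).
Qed.

(** The relation between the two embeddings of an edge group. *)
Lemma step_right_mul y (a : egroup GG y.1) x :
  step y (right_mul (@einj _ GG (orev y) a) x) = right_mul (einj a) (step y x).
Proof.
rewrite /step /right_mul /= coset_repM coset_argM einjM.
by case: (x.1) => [|[z s] stk] //; case: ifP => _ //=; rewrite mulgA.
Qed.

Definition steps (p : seq (oedge Y)) x := foldl (fun x y => step y x) x p.

Lemma steps_cat p q x : steps (p ++ q) x = steps q (steps p x).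
Proof. exact: foldl_cat. Qed.

Lemma at_steps u p v x : walk u p v -> at_state u x -> at_state v (steps p x).
Proof.
elim: p u x => [|y p IHp] u x /=; first by move/eqP->.
by move=> /andP[/eqP yu pv] xu; apply: IHp pv _; apply: at_step; rewrite yu.
Qed.

Lemma steps_rev u p v x : walk u p v -> at_state u x ->
  steps (rev_walk p) (steps p x) = x.
Proof.
elim: p u x => [//|y p IHp] u x /= /andP[/eqP yu pv] xu.
have xy : at_state (oorg y) x by rewrite yu.
rewrite rev_walk_cons steps_cat (IHp _ _ pv) /=; last exact: at_step.
exact: step_rev.
Qed.

Lemma rev_walkK (p : seq (oedge Y)) : rev_walk (rev_walk p) = p.
Proof.
by rewrite /rev_walk map_rev revK -map_comp map_id_in // => y _; apply: orevK.
Qed.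

(** Backtracks act trivially, hence so do closed walks in a tree. *)
Lemma steps_tree (T : subgraph Y) u p x : (forall c, ~ is_circuit T c) ->
  walk u p u -> in_tree T p -> at_state u x -> steps p x = x.
Proof.
move=> noc pu pT.
suff main : forall u v x, at_state u x -> walk u p v -> steps p x = x.
  by move=> /main; apply; apply: pu.
apply: (@tree_walk_closed _ (fun p => forall u v x, at_state u x ->
  walk u p v -> steps p x = x) T noc _ _ u p pu pT) => // {pu pT x}p y q IH a b x xa.
move=> /walk_cat[c pc /= /and3P[/eqP yc _ qb]].
have xc : at_state (oorg y) (steps p x) by rewrite yc; apply: at_steps pc xa.
rewrite steps_cat /= step_rev // -steps_cat; apply: (IH a b) => //.
by apply/walk_cat; exists c => //; rewrite -yc -oterm_orev.
Qed.

End StackMachine.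

(** * The fundamental group acts on normal forms *)

Section Action.
Local Open Scope group_scope.
Context {Y : graph} (GG : graph_of_groups Y) (T : subgraph Y) (v0 : vert Y).
Context (noc : forall c, ~ is_circuit T c).
Context (theta : vert Y -> seq (oedge Y)).
Context (theta_walk : forall v, walk v0 (theta v) v).
Context (theta_tree : forall v, in_tree T (theta v)).
Local Notation P := (vprod GG).
Local Notation at_state := (@at_state Y GG v0).

(** The walks theta v in the tree transport normal forms that end at v0 to
    normal forms that end at v; a letter at v acts through this transport. *)
Definition go v (x : state GG) := steps (theta v) x.
Definition back v (x : state GG) := steps (rev_walk (theta v)) x.

Lemma at_go v x : at_state v0 x -> at_state v (go v x).
Proof. exact: at_steps. Qed.

Lemma at_back v x : at_state v x -> at_state v0 (back v x).
Proof. exact/at_steps/walk_rev. Qed.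

Lemma goK v x : at_state v0 x -> back v (go v x) = x.
Proof. exact: steps_rev. Qed.

Lemma backK v x : at_state v x -> go v (back v x) = x.
Proof.
by move=> xv; rewrite -[RHS](steps_rev (walk_rev (theta_walk v)) xv) rev_walkK.
Qed.

Definition act_letter (x : state GG) (l : letter GG) : state GG :=
  match l with
  | inl h => back (tag h) (right_mul (vinj (tagged h)) (go (tag h) x))
  | inr y => back (oterm y) (step y (go (oorg y) x))
  end.

Definition act (w : seq (letter GG)) (x : state GG) := foldl act_letter x w.

Lemma act_cat w u x : act (w ++ u) x = act u (act w x).
Proof. exact: foldl_cat. Qed.

Lemma at_act w x : at_state v0 x -> at_state v0 (act w x).
Proof.
elim: w x => [//|l w IHw] x xv; apply: IHw.
by case: l => [[v h]|y] /=; apply: at_back; [apply: at_right_mul|apply: at_step];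
  apply: at_go.
Qed.

(** Van der Waerden's argument: the defining relations hold for the action. *)
Lemma act_pi1_eq w u x : pi1_eq T w u -> at_state v0 x -> act w x = act u x.
Proof.
move=> wu; elim: wu x => {w u}.
- by [].
- by move=> w u _ IH x xv; rewrite IH.
- by move=> w u t _ IH1 _ IH2 x xv; rewrite IH1 // IH2.
- move=> w1 w2 u1 u2 _ IH1 _ IH2 x xv; rewrite !act_cat IH1 // IH2 //.
  exact: at_act.
- by move=> v x xv /=; rewrite right_mul1 goK.
- move=> v h k x xv /=; rewrite backK ?right_mulM //.
  exact/at_right_mul/at_go.
- move=> y x xv /=; rewrite oorg_orev backK; last exact/at_step/at_go.
  by rewrite (step_rev (at_go _ xv)) goK.
- move=> y a x xv; have xy := at_go (oorg y) xv; have xs := at_step xy.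
  rewrite /= oorg_orev !backK //; last exact: at_right_mul.
  congr back; rewrite -(step_right_mul a) (step_rev (v0 := v0)) //.
  exact: (at_right_mul (emb GG (orev y) a)).
- move=> y yT x xv; rewrite [RHS]/=.
  have -> : act [:: elet GG y] x =
      steps (theta (oorg y) ++ [:: y] ++ rev_walk (theta (oterm y))) x.
    by rewrite !steps_cat.
  apply: (steps_tree noc _ _ xv).
    apply/walk_cat; exists (oorg y) => //=; rewrite eqxx.
    exact: walk_rev.
  rewrite /in_tree !all_cat -!/(in_tree _ _) theta_tree in_tree_rev theta_tree.
  by rewrite /= yT.
Qed.

(** Vertex groups act freely on the last entry of a normal form. *)
Lemma vertex_inj v (h k : vgroup GG v) :
  pi1_class T [:: vlet h] = pi1_class T [:: vlet k] -> h = k.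
Proof.
move=> /pi1_classP/act_pi1_eq/(_ (at_base GG v0)) /= /(congr1 (go v)).
have xv := at_go v (at_base GG v0).
rewrite !backK; [|exact: at_right_mul..] => -[/mulgI]; exact: vinj_inj.
Qed.

End Action.

(** * The space of normal forms *)

Section Reach.
Context {X : Type} (adj : X -> X -> Prop).

Fixpoint reach k x y : Prop :=
  if k is k'.+1 then x = y \/ exists2 z, adj x z & reach k' z y else x = y.

Lemma reach_refl k x : reach k x x.
Proof. by case: k => //= k; left. Qed.

Lemma reach_le j k x y : j <= k -> reach j x y -> reach k x y.
Proof.
elim: j k x => [|j IHj] [|k] x //=; first by move=> _ ->; left.
by move=> jk [->|[z xz zy]]; [left|right; exists z => //; apply: IHj zy].
Qed.

Lemma reach_trans j k x y z : reach j x y -> reach k y z -> reach (j + k) x z.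
Proof.
elim: j x => [|j IHj] x; first by move->.
move=> [->|[w xw wy]] yz; last by right; exists w => //; apply: IHj yz.
exact: reach_le (leq_addl _ _) yz.
Qed.

Lemma reach1 x y : adj x y -> reach 1 x y.
Proof. by move=> xy; right; exists y. Qed.

Lemma reach_coarse : (forall x y, adj x y -> adj y x) -> coarse reach.
Proof.
move=> adj_sym; split=> [x|k x y|j k l x y z xy yz jkl].
- exact: reach_refl.
- elim: k x => [|k IHk] x /=; first by move->.
  move=> [->|[z xz zy]]; first by left.
  rewrite -[_ \/ _]/(reach k.+1 y x) -addn1.
  by apply: reach_trans (IHk _ zy) _; apply/reach1/adj_sym.
- exact: reach_le jkl (reach_trans xy yz).
Qed.

End Reach.

Lemma uniform_bound (I : eqType) (s : seq I) (Q : I -> nat -> Prop) :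
    (forall i D D', D <= D' -> Q i D -> Q i D') ->
    (forall i, i \in s -> exists D, Q i D) ->
  exists D, forall i, i \in s -> Q i D.
Proof.
move=> Qmono; elim: s => [|i s IHs] Qs; first by exists 0.
have [j js|D1 QD1] := IHs; first by apply: Qs; rewrite inE js orbT.
have [D2 QD2] := Qs i (mem_head _ _).
exists (maxn D1 D2) => j; rewrite inE => /orP[/eqP->|js].
  exact: Qmono (leq_maxr _ _) QD2.
exact: Qmono (leq_maxl _ _) (QD1 _ js).
Qed.

Lemma uniform_bound_fin (I : finType) (Q : I -> nat -> Prop) :
    (forall i D D', D <= D' -> Q i D -> Q i D') ->
    (forall i, exists D, Q i D) ->
  exists D, forall i, Q i D.
Proof.
move=> Qmono Qi.
have [D QD] := uniform_bound (s := enum I) Qmono (fun i _ => Qi i).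
by exists D => i; apply: QD; rewrite mem_enum.
Qed.

Section NormalForms.
Context {Y : graph} (GG : graph_of_groups Y) (T : subgraph Y) (v0 : vert Y).
Context (S : forall v, genset (vgroup GG v)).
Local Notation P := (vprod GG).
Local Notation stack := (seq (oedge Y * P)).
Local Notation at_state := (@at_state Y GG v0).
Local Notation top := (@top Y GG v0).
Implicit Types (x z : state GG) (tau : stack).

(** The normal forms ending at v, with a fixed stack, form a copy of the Cayley
    graph of the vertex group of v. The steps join the copies along the
    Bass--Serre tree, the parent of a stack being its tail. *)
Variant adj x : state GG -> Prop :=
| AdjMul v (h : vgroup GG v) of at_state v x
    & (h \in gens (S v)) || (h^-1%g \in gens (S v)) :
    adj x (right_mul (vinj h) x)
| AdjStep y of at_state (oorg y) x : adj x (step y x).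

Definition state_near := reach adj.

Definition good x := at_state (top x.1) x.

Lemma good_at v x : at_state v x -> good x.
Proof. by move=> xv; have [_ tx _] := xv; rewrite /good tx. Qed.

Lemma at_good v x : good x -> top x.1 = v -> at_state v x.
Proof. by rewrite /good => xt <-. Qed.

Lemma adj_sym x z : adj x z -> adj z x.
Proof.
case=> [v h xv hS|y xy].
  rewrite -[X in adj _ X](_ : right_mul (vinj h^-1%g) (right_mul (vinj h) x) = x).
    by apply: AdjMul; [apply: at_right_mul|rewrite invgK orbC].
  by rewrite right_mulM mulgV right_mul1.
rewrite -[X in adj _ X](step_rev xy); apply: AdjStep.
by rewrite oorg_orev; apply: at_step.
Qed.

Lemma state_near_coarse : coarse state_near.
Proof. exact/reach_coarse/adj_sym. Qed.

Lemma good_adj x z : adj x z -> good z.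
Proof.
case=> [v h xv _|y xy]; first exact: good_at (at_right_mul h xv).
exact: good_at (at_step xy).
Qed.

Lemma good_near k x z : good x -> state_near k x z -> good z.
Proof.
elim: k x => [|k IHk] x gx; rewrite /state_near /=; first by move=> <-.
by move=> [<-//|[w /good_adj gw]]; apply: IHk.
Qed.

(** ** Geometry of the tree of stacks *)

(** The coset of the edge group through which the subtree of tau is entered. *)
Definition edge_state tau x : Prop :=
  x.1 = tau /\ if tau is (y, _) :: _ then exists a : egroup GG y.1, x.2 = einj a
               else False.

Lemma adj_stack x z : adj x z ->
  [\/ z.1 = x.1, behead z.1 = x.1 /\ z.1 <> [::]
    | behead x.1 = z.1 /\ edge_state x.1 x].
Proof.
case=> [v h _ _|y xy]; first by constructor 1.
case: (stepP y x) => [w s stk xE wy r1|_]; last by constructor 2.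
constructor 3; rewrite xE; split=> //; split=> //.
by rewrite wy; exists (coset_arg y x.2); rewrite [LHS](coset_argP y) r1 mul1g.
Qed.

Lemma suffix_consE (p : oedge Y * P) tau (stk : stack) :
  suffix tau (p :: stk) = (tau == p :: stk) || suffix tau stk.
Proof.
apply/idP/orP.
  move=> /suffixP[[|q s] /= e]; first by left; rewrite e.
  by right; apply/suffixP; exists s; case: e.
move=> [/eqP->|/suffixP[s ->]]; first exact: suffix_refl.
by apply/suffixP; exists (p :: s).
Qed.

(** The tree property: the subtree of tau is left only through the edge at tau. *)
Lemma exit_subtree k tau x z :
    state_near k x z -> suffix tau x.1 -> ~~ suffix tau z.1 ->
  exists e w j,
    [/\ j < k, state_near j x e, edge_state tau e, adj e w & w.1 = behead tau].
Proof.
elim: k x => [|k IHk] x; rewrite /state_near /=; first by move=> <- ->.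
move=> [<- ->//|[w xw wz] tx tz].
have [tw|tw] := boolP (suffix tau w.1).
  have [e [u [j [jk we ee eu ut]]]] := IHk _ wz tw tz.
  by exists e, u, j.+1; split=> //; right; exists w.
case: (adj_stack xw) => [wx|[bw wn]|[bx ex]].
- by rewrite wx tx in tw.
- by case: w.1 bw wn tw => //= p stk -> _; rewrite suffix_consE tx orbT.
have xt : x.1 = tau.
  move: tx; case: (x.1) bx => [|p stk] /= bx.
    by rewrite bx (negbTE tw).
  by rewrite suffix_consE bx (negbTE tw) orbF => /eqP->.
by exists x, w, 0; split=> //; rewrite -xt.
Qed.

Lemma size_adj x z : adj x z -> size z.1 <= (size x.1).+1.
Proof.
move=> /adj_stack[->|[+ _]|[<- _]] //.
  by case: (z.1) => //= p stk ->.
by rewrite size_behead; lia.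
Qed.

Lemma size_near k x z : state_near k x z -> size z.1 <= size x.1 + k.
Proof.
elim: k x => [|k IHk] x; rewrite /state_near /=; first by move=> <-; rewrite addn0.
move=> [<-|[w /size_adj xw /IHk wz]]; first by rewrite leq_addr.
by apply: leq_trans wz _; lia.
Qed.

(** ** Evaluation in the fundamental group *)

Local Open Scope group_scope.

Local Notation vcl h := (pi1_class T [:: vlet h]).
Local Notation ycl y := (pi1_class T [:: elet GG y]).

Lemma vcl1 v : vcl (1 : vgroup GG v) = 1.
Proof. by apply/pi1_classP; apply: pi1_vone. Qed.

Lemma vclM v (g h : vgroup GG v) : vcl (g * h) = vcl g * vcl h.
Proof. by rewrite pi1_classM; apply/pi1_classP/pi1_sym/pi1_vmul. Qed.

Lemma vclV v (g : vgroup GG v) : vcl g^-1 = (vcl g)^-1.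
Proof. by apply: (@mulgI _ (vcl g)); rewrite -vclM !mulgV vcl1. Qed.

Lemma ycl_rev (y : oedge Y) : ycl (orev y) = (ycl y)^-1.
Proof.
apply: (@mulgI _ (ycl y)); rewrite mulgV pi1_classM.
by apply/pi1_classP/pi1_erev.
Qed.

Lemma ycl_conj (y : oedge Y) (a : egroup GG y.1) :
  vcl (emb GG (orev y) a) = ycl y * vcl (emb GG y a) * (ycl y)^-1.
Proof. by rewrite -ycl_rev !pi1_classM; apply/pi1_classP/pi1_sym/pi1_edge. Qed.

Definition vev v (p : P) : pi1 GG T := vcl (p v).

Lemma vevM v p q : vev v (p * q) = vev v p * vev v q.
Proof. exact: vclM. Qed.

Lemma vev_vinj v (h : vgroup GG v) : vev v (vinj h) = vcl h.
Proof. by rewrite /vev vinjE. Qed.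

Fixpoint stack_ev tau : pi1 GG T :=
  if tau is (y, s) :: tau' then stack_ev tau' * vev (oorg y) s * ycl y else 1.

(** The element of the fundamental group spelled by a normal form. *)
Definition ev x : pi1 GG T := stack_ev x.1 * vev (top x.1) x.2.

Lemma ev_base : ev (base_state GG) = 1.
Proof. by rewrite /ev /= mul1g /vev vcl1. Qed.

Lemma ev_right_mul v x (h : vgroup GG v) : at_state v x ->
  ev (right_mul (vinj h) x) = ev x * vcl h.
Proof. by move=> [_ tx _]; rewrite /ev /= tx vevM vev_vinj mulgA. Qed.

Lemma ev_step y x : at_state (oorg y) x -> ev (step y x) = ev x * ycl y.
Proof.
move=> [nx tx _]; case: (stepP y x) => [w s stk xE wy r1|_].
  have yw : y = orev w by rewrite wy orevK.
  have x2 : x.2 = @einj _ GG (orev y) (coset_arg y x.2).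
    by rewrite [LHS](coset_argP y) r1 mul1g.
  move: (coset_arg y x.2) x2 => a x2.
  move: nx; rewrite /ev xE x2 /= => -[wt _ _ _ _].
  rewrite -wt wy vevM oorg_orev -!mulgA; congr (_ * (_ * _)).
  by rewrite ycl_rev !vev_vinj ycl_conj mulgVK mulKg.
rewrite /ev /= tx.
rewrite [X in _ = _ * vev _ X * _](coset_argP y) vevM -!mulgA.
congr (_ * (_ * _)).
set a := coset_arg y x.2.
by rewrite -[oorg y]oterm_orev !vev_vinj ycl_conj mulgVK.
Qed.

End NormalForms.

(** * Comparing the metrics *)

Section WordLength.
Local Open Scope group_scope.
Context {G : groupType} (S : genset G).

Lemma word_len_ind (Q : nat -> G -> Prop) :
    Q 0%N 1 ->
    (forall k s g, (s \in gens S) || (s^-1 \in gens S) -> Q k g -> Q k.+1 (s * g)) ->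
  forall g, Q (word_len S g) g.
Proof.
move=> Q1 Qs g; have [w [Sw <-] <-] := word_lenP S g.
elim: w Sw => [|s w IHw] /=; first by rewrite big_nil.
by move=> /andP[sS wS]; rewrite big_cons; apply: Qs => //; apply: IHw.
Qed.

Lemma word_len_gen (s : G) :
  (s \in gens S) || (s^-1 \in gens S) -> word_len S s <= 1.
Proof.
by move=> sS; apply: (@word_len_le _ _ _ [:: s]); split; rewrite ?big_seq1 //= sS.
Qed.

Lemma word_ball_finite k : exists L : seq G, forall g, word_len S g <= k -> g \in L.
Proof.
pose gs := enum_fset (gens S) ++ [seq s^-1 | s <- enum_fset (gens S)].
pose fix B k := if k is k'.+1 then 1 :: [seq s * g | s <- gs, g <- B k'] else [:: 1].
suff main : forall g k, word_len S g <= k -> g \in B k.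
  by exists (B k) => g; apply: main.
move=> g; apply: (@word_len_ind (fun j g => forall k, j <= k -> g \in B k)) => {g k}.
  by case=> [|k] _; rewrite /= inE eqxx.
move=> j s g sS IH [//|k] jk; rewrite inE; apply/orP; right.
apply/allpairsP; exists (s, g); split=> //=; last exact: IH.
rewrite mem_cat; case/orP: sS => sS; first by rewrite sS.
by apply/orP; right; apply/mapP; exists s^-1; rewrite ?invgK.
Qed.

End WordLength.

Section Comparison.
Local Open Scope group_scope.
Context {Y : graph} (GG : graph_of_groups Y) (T : subgraph Y) (v0 : vert Y).
Context (noc : forall c, ~ is_circuit T c).
Context (theta : vert Y -> seq (oedge Y)).
Context (theta_walk : forall v, walk v0 (theta v) v).
Context (theta_tree : forall v, in_tree T (theta v)).
Context (S : forall v, genset (vgroup GG v)) (Spi : genset (pi1 GG T)).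
Local Notation at_state := (@at_state Y GG v0).
Local Notation near := (@state_near Y GG v0 S).
Local Notation ev := (@ev Y GG T v0).
Local Notation vcl h := (pi1_class T [:: vlet h]).
Local Notation ycl y := (pi1_class T [:: elet GG y]).
Local Notation len := (word_len Spi).
Local Notation act := (act theta).

Let nearP := @state_near_coarse Y GG v0 S.

(** Words in the generators of a vertex group are paths of normal forms. *)
Lemma near_right_mul v x (h : vgroup GG v) : at_state v x ->
  near (word_len (S v) h) x (right_mul (vinj h) x).
Proof.
move: x; apply: (@word_len_ind _ (S v) (fun k h => forall x, at_state v x ->
  near k x (right_mul (vinj h) x))) => [x xv|k s g sS IH x xv].
  by rewrite right_mul1; apply: near0 nearP x.
rewrite -right_mulM; right; exists (right_mul (vinj s) x); first exact: AdjMul.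
exact/IH/at_right_mul.
Qed.

Lemma near_steps u p v x : walk u p v -> at_state u x -> near (size p) x (steps p x).
Proof.
elim: p u x => [//|y p IHp] u x /= /andP[/eqP yu pv] xu.
have xy : at_state (oorg y) x by rewrite yu.
right; exists (step y x); first exact: AdjStep.
exact: IHp pv (at_step xy).
Qed.

Lemma near_act w : exists K, forall x, at_state v0 x -> near K x (act w x).
Proof.
elim: w => [|l w [K IHw]]; first by exists 0%N => x _; apply: near0 nearP x.
suff [K' lK] : exists K', forall x, at_state v0 x -> near K' x (act [:: l] x).
  exists (K' + K)%N => x xv.
  apply: (near_trans nearP (lK _ xv) (IHw _ _) (leqnn _)).
  exact: (at_act theta_walk [:: l] xv).
have near_go v x : at_state v0 x -> near (size (theta v)) x (go theta v x).
  exact: near_steps (theta_walk v).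
have near_back v x : at_state v x ->
    near (size (rev_walk (theta v))) x (back theta v x).
  exact: near_steps (walk_rev (theta_walk v)).
case: l => [[v h]|y].
  exists (size (theta v) + word_len (S v) h + size (rev_walk (theta v)))%N => x xv.
  have xg := at_go theta_walk v xv.
  have h1 := near_trans nearP (near_go v _ xv) (near_right_mul h xg) (leqnn _).
  exact: (near_trans nearP h1 (near_back v _ (at_right_mul h xg)) (leqnn _)).
exists (size (theta (oorg y)) + 1 + size (rev_walk (theta (oterm y))))%N => x xv.
have xg := at_go theta_walk (oorg y) xv.
have xs : near 1 (go theta (oorg y) x) (step y (go theta (oorg y) x)).
  exact/reach1/AdjStep.
have h1 := near_trans nearP (near_go _ _ xv) xs (leqnn _).
exact: (near_trans nearP h1 (near_back _ _ (at_step xg)) (leqnn _)).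
Qed.

Lemma ev_steps_tree u p v x : walk u p v -> in_tree T p -> at_state u x ->
  ev (steps p x) = ev x.
Proof.
elim: p u x => [//|y p IHp] u x /= /andP[/eqP yu pv] /andP[yT pT] xu.
have xy : at_state (oorg y) x by rewrite yu.
rewrite (IHp _ _ pv pT (at_step xy)) ev_step //.
by rewrite ((pi1_classP T [:: elet GG y] [::]).2 (pi1_tree _ yT)) mulg1.
Qed.

(** The letters of the tree are trivial, so that the transport along theta is
    not seen by the evaluation. *)
Lemma ev_act w x : at_state v0 x -> ev (act w x) = ev x * pi1_class T w.
Proof.
have cl0 : pi1_class T [::] = 1 :> pi1 GG T by [].
elim: w x => [|l w IHw] x xv; first by rewrite cl0 mulg1.
rewrite -[act _ _]/(act w (act [:: l] x)) IHw;
  last exact: (at_act theta_walk [:: l] xv).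
rewrite -[l :: w]/([:: l] ++ w) -pi1_classM mulgA; congr (_ * _).
have ev_go v : ev (go theta v x) = ev x by apply: ev_steps_tree (theta_walk v) _ xv.
have ev_back v z : at_state v z -> ev (back theta v z) = ev z.
  by apply: ev_steps_tree (walk_rev (theta_walk v)) _; rewrite in_tree_rev.
case: l => [[v h]|y] /=.
  have xg := at_go theta_walk v xv.
  by rewrite ev_back ?ev_right_mul ?ev_go //; apply: at_right_mul.
have xg := at_go theta_walk (oorg y) xv.
by rewrite ev_back ?ev_step ?ev_go //; apply: at_step.
Qed.

(** The normal form of g; [ev] is a left inverse. *)
Definition alpha (g : pi1 GG T) : state GG := act (repr g) (base_state GG).

Lemma at_alpha g : at_state v0 (alpha g).
Proof. exact/at_act/at_base. Qed.

Lemma ev_alpha g : ev (alpha g) = g.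
Proof.
rewrite ev_act; last exact: at_base.
by rewrite ev_base mul1g; apply: reprK.
Qed.

Lemma alphaM g s : alpha (g * s) = act (repr s) (alpha g).
Proof.
rewrite /alpha -act_cat; apply: (act_pi1_eq noc theta_walk theta_tree) (at_base _ _).
by apply/pi1_classP; rewrite -pi1_classM /pi1_class !reprK.
Qed.

Lemma near_alpha : exists K, forall g h,
  near (K * len (g^-1 * h)) (alpha g) (alpha h).
Proof.
have [K KP] : exists K, forall s, s \in enum_fset (gens Spi) ->
    forall g, near K (alpha g) (alpha (g * s)).
  apply: uniform_bound => [s D D' DD nD g|s _].
    exact: (near_le nearP DD (nD g)).
  have [K KP] := near_act (repr s); exists K => g.
  by rewrite alphaM; apply/KP/at_alpha.
exists K => g h; have -> : alpha h = alpha (g * (g^-1 * h)) by rewrite mulVKg.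
move: (g^-1 * h) => {}h; move: g.
apply: (@word_len_ind _ Spi
  (fun k h => forall g, near (K * k) (alpha g) (alpha (g * h)))).
  by move=> g; rewrite mulg1 muln0; apply: near0 nearP _.
move=> k s {}h sS IH g.
have gs : near K (alpha g) (alpha (g * s)).
  case/orP: sS => sS; first exact: KP.
  by have := near_sym nearP (KP _ sS (g * s)); rewrite mulgK.
by rewrite mulgA; apply: (near_trans nearP gs (IH (g * s))); rewrite mulnS.
Qed.

Lemma len_letters : exists C,
  (forall y, len (ycl y) <= C)%N /\
  forall v (h : vgroup GG v), (len (vcl h) <= C * word_len (S v) h)%N.
Proof.
have [C1 C1P] : exists C, forall y : oedge Y, (len (ycl y) <= C)%N.
  apply: uniform_bound_fin => [y D D' DD|y]; first by move/leq_trans; apply.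
  by exists (len (ycl y)).
have [C2 C2P] : exists C, forall v, forall h : vgroup GG v,
    h \in enum_fset (gens (S v)) -> (len (vcl h) <= C)%N.
  apply: uniform_bound_fin => [v D D' DD hD h hS|v].
    exact: leq_trans (hD _ hS) DD.
  apply: uniform_bound => [h D D' DD|h _]; first by move/leq_trans; apply.
  by exists (len (vcl h)).
exists (C1 + C2)%N; split=> [y|v h]; first exact: leq_trans (C1P y) (leq_addr _ _).
suff : (len (vcl h) <= C2 * word_len (S v) h)%N.
  by move=> /leq_trans; apply; rewrite leq_mul2r leq_addl orbT.
apply: (@word_len_ind _ (S v) (fun k h => len (vcl h) <= C2 * k)%N).
  by rewrite vcl1 word_len1.
move=> k s g sS IH; rewrite vclM mulnS; apply: leq_trans (word_lenM _ _ _) _.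
apply: leq_add => //; case/orP: sS => sS; first exact: C2P.
by have := C2P _ _ sS; rewrite vclV word_lenV.
Qed.

(** Adjacent normal forms differ by a generator of a vertex group or by an edge,
    and these have bounded length. *)
Lemma len_near : exists C, forall k x z, good v0 x -> near k x z ->
  (len ((ev x)^-1 * ev z) <= C * k)%N.
Proof.
have [C [Cy Cv]] := len_letters; exists C; elim=> [|k IHk] x z gx.
  by move=> <-; rewrite mulVg word_len1.
move=> [<-|[w xw wz]]; first by rewrite mulVg word_len1.
have gw := good_adj xw; have {IHk wz}wz := IHk _ _ gw wz.
have -> : (ev x)^-1 * ev z = ((ev x)^-1 * ev w) * ((ev w)^-1 * ev z).
  by rewrite -mulgA mulVKg.
apply: leq_trans (word_lenM _ _ _) _; rewrite mulnS; apply: leq_add => //.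
case: xw {wz gw} => [v h xv hS|y xy].
  rewrite ev_right_mul // mulKg; apply: leq_trans (Cv _ _) _.
  by have := word_len_gen hS; case: (word_len _ _) => [|[]]; rewrite ?muln0 ?muln1.
by rewrite ev_step // mulKg.
Qed.

(** A ball of the fundamental group is finite and meets the image of a vertex
    group in finitely many elements, each the image of just one. *)
Lemma vertex_proper v k : exists f, forall h : vgroup GG v,
  (len (vcl h) <= k -> word_len (S v) h <= f)%N.
Proof.
have [L LP] := word_ball_finite Spi k.
suff [f fP] : exists f, forall g, g \in L -> forall h : vgroup GG v,
    vcl h = g -> (word_len (S v) h <= f)%N.
  by exists f => h /LP/fP; apply.
apply: uniform_bound => [g D D' DD gD h hg|g _].
  exact: leq_trans (gD _ hg) DD.
have [[h hg]|no] := pselect (exists h : vgroup GG v, vcl h = g).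
  exists (word_len (S v) h) => k'; rewrite -hg.
  by move=> /(vertex_inj noc theta_walk theta_tree)->.
by exists 0%N => h hg; case: no; exists h.
Qed.

(** The two embeddings of an edge group are conjugate by the edge, so that its
    word metrics from both ends are coarsely equivalent. *)
Lemma edge_proper (y : oedge Y) k : exists f, forall a : egroup GG y.1,
  (word_len (S (oterm y)) (emb GG y a) <= k ->
   word_len (S (oterm (orev y))) (emb GG (orev y) a) <= f)%N.
Proof.
have [C [Cy Cv]] := len_letters.
have [f fP] := vertex_proper (oterm (orev y)) (C + C * k + C).
exists f => a ak; apply: fP; rewrite ycl_conj.
apply: leq_trans (word_lenM _ _ _) (leq_add _ _); last by rewrite word_lenV.
apply: leq_trans (word_lenM _ _ _) (leq_add _ _); first exact: Cy.
by apply: leq_trans (Cv _ _) _; rewrite leq_mul2l ak orbT.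
Qed.

End Comparison.

Lemma emb_ldiv (Y : graph) (GG : graph_of_groups Y) (y : oedge Y)
    (a b : egroup GG y.1) :
  ((emb GG y a)^-1 * emb GG y b = emb GG y (a^-1 * b))%g.
Proof. by apply: (@mulgI _ (emb GG y a)); rewrite mulVKg -gmulfM mulVKg. Qed.

(** * Covers of the space of normal forms *)

Section Assembly.
Context {Y : graph} (GG : graph_of_groups Y) (T : subgraph Y) (v0 : vert Y).
Context (noc : forall c, ~ is_circuit T c).
Context (theta : vert Y -> seq (oedge Y)).
Context (theta_walk : forall v, walk v0 (theta v) v).
Context (theta_tree : forall v, in_tree T (theta v)).
Context (S : forall v, genset (vgroup GG v)) (Spi : genset (pi1 GG T)) (n : nat).
Local Notation P := (vprod GG).
Local Notation stack := (seq (oedge Y * P)).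
Local Notation top := (@top Y GG v0).
Local Notation good := (@good Y GG v0).
Local Notation state_near := (@state_near Y GG v0 S).
Local Notation ev := (@ev Y GG T v0).
Local Notation alpha := (@alpha Y GG T theta).
Implicit Types (x z : state GG) (tau : stack).

Definition vertex_near v k (g h : vgroup GG v) : Prop :=
  word_len (S v) (g^-1 * h)%g <= k.

Definition edge_near y k (a b : egroup GG y.1) : Prop :=
  word_len (S (oterm y)) (emb GG y (a^-1 * b)%g) <= k.

Context (vertex_cover : forall v r, exists D,
  coloured (@vertex_near v) setT n.+1 r D).
Context (edge_cover : forall y r, exists D, coloured (@edge_near y) setT n r D).

Let nearP := @state_near_coarse Y GG v0 S.

Definition vertex_coset tau : set (state GG) := [set x | good x /\ x.1 = tau].

Lemma near_vertex_coset tau x z :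
  vertex_coset tau x -> vertex_coset tau z ->
  ((ev x)^-1 * ev z)%g =
    pi1_class T [:: vlet ((x.2 (top tau))^-1 * z.2 (top tau))%g] :> pi1 GG T /\
  state_near (word_len (S (top tau)) ((x.2 (top tau))^-1 * z.2 (top tau))%g) x z.
Proof.
move=> [gx xt] [gz zt]; split.
  by rewrite /ev xt zt invgM -mulgA mulKg vclM vclV.
have [nx _ [h xh]] := gx; have [_ _ [k zk]] := gz.
have xa := at_good gx (congr1 top xt).
rewrite xh zk {nx}; rewrite xt in h xh *; rewrite zt in k zk *.
rewrite !vinjE.
suff <- : right_mul (vinj (h^-1 * k)%g) x = z by exact: near_right_mul.
rewrite /right_mul xh -vinjM mulVKg -zk xt -zt.
by case: (z).
Qed.

Lemma vertex_cosets_coloured r : exists D, forall tau,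
  coloured state_near (vertex_coset tau) n.+1 r D.
Proof.
have [C CP] := len_near v0 S Spi.
suff [D DP] : exists D, forall v tau, top tau = v ->
    coloured state_near (vertex_coset tau) n.+1 r D.
  by exists D => tau; apply: DP.
apply: uniform_bound_fin => [v D D' DD cD tau tv|v].
  exact: (coloured_le nearP (leqnn _) (leqnn _) DD (cD _ tv)).
have [f fP] := vertex_proper noc theta_walk theta_tree S Spi v (C * r).
have [D cD] := vertex_cover v f; exists D => tau tv; subst v.
apply: (coloured_pull (q := fun x => x.2 (top tau)) _ _ _ cD) => // x z xt zt.
  move=> xz; apply: fP; have [<- _] := near_vertex_coset xt zt.
  by apply: CP xz; case: xt.
move=> xz; have [_] := near_vertex_coset xt zt.
exact: (near_le nearP xz).
Qed.

Definition edge_coset tau : set (state GG) :=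
  [set x | good x /\ edge_state tau x].

Lemma edge_cosets_coloured r : exists D, forall tau,
  coloured state_near (edge_coset tau) n r D.
Proof.
have [C CP] := len_near v0 S Spi.
suff [D DP] : exists D, forall (y : oedge Y) s tau,
    coloured state_near (edge_coset ((y, s) :: tau)) n r D.
  exists D => -[|[y s] tau]; last exact: DP.
  by exists (fun _ => 0), (fun _ => set0); split=> [x [_ []]|x z [_ []]|].
apply: uniform_bound_fin => [y D D' DD cD s tau|y].
  exact: (coloured_le nearP (leqnn _) (leqnn _) DD (cD _ _)).
have [f fP] := vertex_proper noc theta_walk theta_tree S Spi (oterm y) (C * r).
have [D cD] := edge_cover y f; exists D => s tau.
pose q (x : state GG) := xget 1%g [set a : egroup GG y.1 | x.2 = einj a].
have qP x : edge_coset ((y, s) :: tau) x -> x.2 = einj (q x).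
  by move=> [_ [_ xa]]; apply: (xgetPex (P := [set a | x.2 = einj a]) 1%g xa).
have vx x : edge_coset ((y, s) :: tau) x -> vertex_coset ((y, s) :: tau) x.
  by move=> [gx []].
have qM x z : edge_coset ((y, s) :: tau) x -> edge_coset ((y, s) :: tau) z ->
    ((x.2 (oterm y))^-1 * z.2 (oterm y) = emb GG y ((q x)^-1 * q z))%g.
  by move=> /qP-> /qP->; rewrite /einj !vinjE emb_ldiv.
apply: (coloured_pull (q := q) _ _ _ cD) => // x z xt zt.
  move=> xz; apply: fP; have [/= e _] := near_vertex_coset (vx _ xt) (vx _ zt).
  rewrite -qM // -e; by apply: CP xz; case: xt.
move=> xz; have [_ /=] := near_vertex_coset (vx _ xt) (vx _ zt).
by rewrite qM //; apply: (near_le nearP xz).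
Qed.

Definition subtree R tau : set (state GG) :=
  [set x | [/\ good x, suffix tau x.1 & size x.1 <= size tau + R]].

(** Induction on R: outside the r-neighbourhood of the vertex space of tau, the
    subtrees of distinct children of tau are r-apart, since a path from one to
    the other passes through that vertex space. *)
Lemma subtrees_coloured R r : exists D, forall tau,
  coloured state_near (subtree R tau) n.+1 r D.
Proof.
elim: R => [|R [D IHR]].
  have [D DP] := vertex_cosets_coloured r; exists D => tau.
  apply: coloured_sub (DP tau) => x [gx /suffixP[s xs]]; rewrite xs size_cat => s0.
  by split=> //; rewrite xs; case: s s0 {xs} => //= p s; lia.
have [E EP] := vertex_cosets_coloured (r.*2 + D + r.*2).
exists (E + r.*2 + (r + D).*2) => tau.
pose Z := [set x | exists2 z, vertex_coset tau z & state_near r x z].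
have ZE : coloured state_near Z n.+1 (r.*2 + D) (E + r.*2).
  exact: coloured_thicken (EP tau).
pose child x : stack := drop (size x.1 - (size tau).+1) x.1.
have childP x : subtree R.+1 tau x -> ~ Z x ->
    [/\ size (child x) = (size tau).+1, suffix (child x) x.1
      & behead (child x) = tau].
  move=> [gx /suffixP[s xs] _] nZ.
  case/lastP: s => [|s p] in xs.
    by case: nZ; exists x; [split|exact: (near_le nearP (leq0n _) (near0 nearP x))].
  have -> : child x = p :: tau.
    rewrite /child xs size_cat size_rcons.
    have -> : ((size s).+1 + size tau - (size tau).+1)%N = size s by lia.
    by rewrite cat_rcons drop_size_cat.
  by split=> //; rewrite xs cat_rcons suffix_suffix.
apply: (coloured_sub (A := Z `|` subtree R.+1 tau)); first exact: subsetUr.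
apply: (coloured_union nearP (idx := child) (leqnn _) ZE) => [i|x z xt zt nx nz xz].
  apply: coloured_sub (IHR i) => x [xt nZ <-].
  have [sc cx ct] := childP _ xt nZ; have [gx _ sx] := xt.
  by split=> //; rewrite sc addSnnS.
have [sx cx bx] := childP _ xt nx; have [sz cz bz] := childP _ zt nz.
have [cz'|/(exit_subtree xz cx)] := boolP (suffix (child x) z.1).
  have [s zs] := suffixP cz'.
  by rewrite [child z]/child zs size_cat sx addnK drop_size_cat.
move=> [e [w [j [jr xe _ ew]]]]; rewrite bx => wt; case: nx; exists w.
  by split=> //; apply: good_adj ew.
by apply: (near_trans nearP xe (reach1 ew)); lia.
Qed.

Lemma suffix_drop i tau : suffix (drop i tau) tau.
Proof. by apply/suffixP; exists (take i tau); rewrite cat_take_drop. Qed.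

Lemma drop_suffix (sigma tau : stack) : suffix sigma tau ->
  drop (size tau - size sigma) tau = sigma.
Proof. by move=> /suffixP[s ->]; rewrite size_cat addnK drop_size_cat. Qed.

Let near_pi1 k (g h : pi1 GG T) := state_near k (alpha g) (alpha h).

Lemma near_pi1_coarse : coarse near_pi1.
Proof.
split=> [g|k g h|j k l f g h].
- exact: (near0 nearP).
- exact: (near_sym nearP).
- exact: (near_trans nearP).
Qed.

(** The walls are erected beyond those stacks tau whose length is a multiple of
    H. Their collars have width M, and they stand at depth m = M + 2r: all
    points 2r-close to a collar lie in its subtree, so that collars of one level
    are more than 2r apart. The length H exceeds the depth M + m of the collars,
    which separates those of different levels. *)
Lemma pi1_thin_cover r : exists D, thin_cover near_pi1 n.+1 r D.
Proof.
pose M := r.*2 * n.+1; pose m := M + r.*2; pose H := (M + m).+1.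
(* [deep tau x]: x lies at depth more than m in the subtree of tau *)
pose deep tau x := forall z, state_near m x z -> suffix tau z.1.
(* the collar of the wall beyond tau, at depth more than 2r and at most M + m *)
pose band tau : set (state GG) := [set x | [/\ good x, exists k, size tau = k * H,
  forall z, state_near r.*2 x z -> suffix tau z.1
  & exists2 z, state_near (M + m) x z & ~~ suffix tau z.1]].
have self k x : state_near k x x by apply: (near_le nearP (leq0n _) (near0 nearP x)).
have band_edge tau x : band tau x ->
    (exists2 e, edge_coset tau e & state_near (M + m) x e) /\
    size x.1 < size tau + H.
  move=> [gx _ tin [z xz tz]].
  have [e [w [j [jlt xe et _ _]]]] := exit_subtree xz (tin _ (self _ x)) tz.
  split; last first.
    by have := size_near (near_sym nearP xe); have [-> _] := et; rewrite /H; lia.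
  exists e; first by split=> //; apply: good_near gx xe.
  by apply: (near_le nearP _ xe); apply: ltnW.
have [D1 bandD1] : exists D, forall tau, coloured state_near (band tau) n r.*2 D.
  have [D DP] := edge_cosets_coloured (r.*2 + (M + m).*2).
  exists (D + (M + m).*2) => tau.
  apply: coloured_sub (coloured_thicken nearP (DP tau)) => x /band_edge[] //.
have band_sep tau sigma x z : band tau x -> band sigma z -> state_near r.*2 x z ->
    tau = sigma.
  move=> bx bz xz.
  have [_ xlt] := band_edge _ _ bx; have [_ zlt] := band_edge _ _ bz.
  case: bx bz => _ [k tk] tin _ [_ [l sl] sin _].
  have sx := sin _ (near_sym nearP xz); have tx := tin _ (self _ x).
  have h2 := leq_ltn_trans (size_suffix sx) xlt.
  have h1 := leq_ltn_trans (size_suffix (tin _ xz)) zlt.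
  suff kl : k = l by rewrite -(drop_suffix sx) -(drop_suffix tx) tk sl kl.
  by move: h1 h2; rewrite tk sl -!mulSnr !ltn_pmul2r //; lia.
(* the piece of x is the last wall crossed on the way from the root to x *)
pose cut x k : stack := drop (size x.1 - k * H) x.1.
pose cand x k := k * H <= size x.1 /\ deep (cut x k) x.
have /choice[lev levP] x : exists k, cand x k /\ forall j, cand x j -> j <= k.
  have ex : exists k, `[< cand x k >].
    exists 0; apply/asboolP; split=> // z _.
    by rewrite /cut mul0n subn0 drop_size suffix0s.
  have ub k : `[< cand x k >] -> k <= size x.1.
    by move=> /asboolP[kH _]; rewrite /H in kH; nia.
  case: (ex_maxnP ex ub) => k /asboolP ck kmax.
  by exists k; split=> // j /asboolP/kmax.
pose piece x := cut x (lev x).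
have size_piece x : size (piece x) = lev x * H.
  by have [[lx _] _] := levP x; rewrite size_drop subKn.
have deep_lev tau x k : size tau = k * H -> suffix tau x.1 -> cut x k = tau.
  by move=> tk tx; rewrite /cut -tk drop_suffix.
have walls x z : good x -> good z -> state_near M x z -> piece x <> piece z ->
    exists tau, band tau x /\ band tau z.
  (* the wall at the piece of greater level separates x and z *)
  wlog zx : x z / lev z <= lev x => [main gx gz xz pxz|].
    have [zx|/ltnW xlz] := leqP (lev z) (lev x); first exact: main.
    have [|tau [bz bx]] := main z x xlz gz gx (near_sym nearP xz).
      by move=> e; apply: pxz.
    by exists tau.
  move=> gx gz xz pxz; exists (piece x).
  have [[_ dx] _] := levP x.
  have [u zu tu] : exists2 u, state_near m z u & ~~ suffix (piece x) u.1.
    apply: contrapT => no; apply: pxz.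
    have dz : deep (piece x) z.
      move=> u zu; apply: contrapT => /negP tu; apply: no; by exists u.
    have cz := deep_lev _ _ _ (size_piece x) (dz _ (self _ z)).
    have lz : lev x <= lev z.
      apply: (levP z).2; split; last by rewrite cz.
      by rewrite -size_piece; apply/size_suffix/dz.
    by rewrite -[LHS]cz; congr (cut z _); apply/eqP; rewrite eqn_leq lz.
  split; split=> //; try by exists (lev x).
  - by move=> w xw; apply: dx; apply: (near_le nearP _ xw); rewrite leq_addl.
  - by exists u => //; apply: (near_trans nearP xz zu).
  - by move=> w zw; apply: dx; apply: (near_trans nearP xz zw).
  - by exists u => //; apply: (near_le nearP _ zu); rewrite leq_addl.
have piece_subtree x : good x -> subtree H.*2 (piece x) x.
  move=> gx; split=> //; first exact: suffix_drop.
  rewrite size_piece.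
  have H0 : 0 < H by [].
  have := divn_eq (size x.1) H; have := ltn_pmod (size x.1) H0.
  case: (size x.1 %/ H) => [|k] xlt xk; first by lia.
  suff /(levP x).2 kl : cand x k by nia.
  have kx : k * H <= size x.1 by nia.
  split=> // z xz; apply: contrapT => /negP tz.
  have [e [w [j [jlt xe [et _] _ _]]]] := exit_subtree xz (suffix_drop _ _) tz.
  have := size_near (near_sym nearP xe); rewrite et size_drop subKn //.
  have mH : m < H by rewrite /H ltnS leq_addl.
  rewrite [size x.1]xk mulSn; move: (k * H) (_ %% _) mH jlt => a b.
  by clearbody H m; lia.
have [D2 treeD2] := subtrees_coloured H.*2 (r + D1).*2.
exists (D2 + D1.*2).
apply: (thin_cover_of_partition near_pi1_coarse (piece := piece \o alpha)).
  apply: (coloured_pull (q := alpha) (B := [set x | exists tau, band tau x]));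
    last first.
  - exact: (coloured_disjoint_union (A := band) bandD1).
  - by [].
  - by [].
  - move=> g [h gh pgh].
    have good_alpha f : good (alpha f) := good_at (at_alpha theta_walk f).
    have [|tau [bg _]] := walls _ _ (good_alpha g) (good_alpha h) gh.
      by move=> e; apply: pgh.
    by exists tau.
move=> tau; apply: (coloured_pull (q := alpha) _ _ _ (treeD2 tau)) => // g <-.
exact: (piece_subtree _ (good_at (at_alpha theta_walk _))).
Qed.

Lemma pi1_word_thin_cover r : exists D,
  thin_cover (fun k (g h : pi1 GG T) => word_len Spi (g^-1 * h)%g <= k) n.+1 r D.
Proof.
have [K KP] := near_alpha noc theta_walk theta_tree S Spi.
have [C CP] := len_near v0 S Spi.
have [D [L [lab [labD labn]]]] := pi1_thin_cover (K * r).
exists (C * D), L, lab; split=> [g h /labD gh|g].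
  rewrite -[g](ev_alpha theta_walk theta_tree) -[h](ev_alpha theta_walk theta_tree).
  by apply: CP gh; exact: (good_at (at_alpha theta_walk _)).
have [f fP] := labn g; exists f => h gh; apply: fP.
by apply: (near_le nearP _ (KP g h)); rewrite leq_mul2l gh orbT.
Qed.

End Assembly.

(** * The dimension of the fundamental group *)

(** A nonempty set of natural numbers has a least element. *)
Lemma asdim_cases (R : realType) (X : metricType R) :
  asdim X = +oo%E \/ exists2 n, asdim_le X n & asdim X = n%:R%:E.
Proof.
have [ex|no] := pselect (exists n, asdim_le X n); last first.
  left; rewrite /asdim (_ : [set _ | _ in _] = set0) ?ereal_inf0 //.
  by rewrite -subset0 => t [n Xn _]; case: no; exists n.
right; have exb : exists n, `[< asdim_le X n >].
  by have [n Xn] := ex; exists n; apply/asboolP.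
case: (ex_minnP exb) => n /asboolP Xn nmin; exists n => //.
apply/eqP; rewrite eq_le; apply/andP; split; first exact/asdim_leP.
apply: le_ereal_inf_tmp => _ [m Xm <-].
by rewrite lee_fin ler_nat; apply/nmin/asboolP.
Qed.

(** Edge groups are given with the metric of one of their ends; [edge_proper]
    provides covers for the metric of the other end. *)
Lemma asdim_le_pi1 (R : realType) (Y : graph) (GG : graph_of_groups Y)
    (T : subgraph Y) (S : forall v : vert Y, genset (vgroup GG v))
    (Spi : genset (pi1 GG T)) (side : edge Y -> bool) n :
  connected_graph Y -> is_maximal_tree T ->
  (forall v, asdim_le (word_space R (S v)) n) ->
  (forall e, exists2 m, m < n & asdim_le (edge_space R S (e, side e)) m) ->
  asdim_le (word_space R Spi) n.
Proof.
move=> Yconn Tmax Sn en; have [[v0 _] _] := Yconn.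
have spanning := maximal_tree_spanning Yconn Tmax.
have [[Tconn noc] _] := Tmax.
have /choice[theta thetaP] v : exists p, walk v0 p v /\ in_tree T p.
  by have [p] := tree_walk Tconn (spanning v0) (spanning v); exists p.
have theta_walk v := (thetaP v).1; have theta_tree v := (thetaP v).2.
apply: asdim_le_of_thin_cover => r.
have vertex_cover v s : exists D, coloured (@vertex_near _ GG S v) setT n.+1 s D.
  have [D cD] := coloured_of_asdim_le (Sn v) s; exists D.
  by apply: (coloured_pull (q := id) _ _ _ cD) => // g h _ _;
    rewrite /mnear /mdist /= ler_nat.
have side_cover e s : exists D, coloured (@edge_near _ GG S (e, side e)) setT n s D.
  have [m mn em] := en e; have [D cD] := coloured_of_asdim_le em s; exists D.
  have {}cD := coloured_le (mnear_coarse _) mn (leqnn s) (leqnn D) cD.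
  apply: (coloured_pull (q := id) _ _ _ cD) => // a b _ _;
    by rewrite /edge_near -emb_ldiv /mnear /mdist /= ler_nat.
have edge_cover y s : exists D, coloured (@edge_near _ GG S y) setT n s D.
  case: y => e b; have [->|bs] := eqVneq b (side e); first exact: side_cover.
  have -> : b = ~~ side e by case: b (side e) bs => [] [].
  have [f fP] : exists f, forall a : egroup GG e,
      word_len (S (oterm (e, ~~ side e))) (emb GG (e, ~~ side e) a) <= s ->
      word_len (S (oterm (e, side e))) (emb GG (e, side e) a) <= f.
    case: (side e).
      exact: (edge_proper noc theta_walk theta_tree S Spi (e, false) s).
    exact: (edge_proper noc theta_walk theta_tree S Spi (e, true) s).
  have [D cD] := side_cover e f.
  have [f' fP'] := edge_proper noc theta_walk theta_tree S Spi (e, side e) D.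
  exists f'.
  apply: (coloured_pull (q := id) _ _ _ cD) => // a c _ _; first exact: fP.
  exact: fP'.
have [D cD] :=
  pi1_word_thin_cover noc theta_walk theta_tree Spi vertex_cover edge_cover r.
exists D; have [L [lab [labD labn]]] := cD.
exists L, lab; split=> [g h /labD|g]; first by rewrite /mnear /mdist /= ler_nat.
by have [f fP] := labn g; exists f => h; rewrite /mnear /mdist /= ler_nat => /fP.
Qed.

Local Open Scope ring_scope.
Local Open Scope ereal_scope.

Theorem theorem1p4 (R : realType) (Y : graph) (GG : graph_of_groups Y)
    (T : subgraph Y) (S : forall v : vert Y, genset (vgroup GG v))
    (Spi : genset (pi1 GG T)) (side : edge Y -> bool) :
  connected_graph Y ->
  is_maximal_tree T ->
  asdim (word_space R Spi) <=
    maxe (\big[maxe/-oo]_(v : vert Y) asdim (word_space R (S v)))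
         (\big[maxe/-oo]_(e : edge Y) (asdim (edge_space R S (e, side e)) + 1)).
Proof.
move=> Yconn Tmax; have [[v0 _] _] := Yconn.
set b := maxe _ _.
have vb v : asdim (word_space R (S v)) <= b.
  by rewrite le_max; apply/orP; left; apply: le_bigmax.
have eb e : asdim (edge_space R S (e, side e)) + 1 <= b.
  by rewrite le_max; apply/orP; right;
    apply: (le_bigmax _ (fun e => asdim (edge_space R S (e, side e)) + 1)).
have [->|boo] := eqVneq b +oo; first exact: leey.
have /choice[nv nvP] v : exists n,
    asdim_le (word_space R (S v)) n /\ asdim (word_space R (S v)) = n%:R%:E.
  have [voo|[n]] := asdim_cases (word_space R (S v)); last by exists n.
  by move: (vb v); rewrite voo leye_eq (negbTE boo).
have /choice[ne neP] e : exists m, asdim_le (edge_space R S (e, side e)) m /\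
    asdim (edge_space R S (e, side e)) = m%:R%:E.
  have [eoo|[m]] := asdim_cases (edge_space R S (e, side e)); last by exists m.
  by move: (eb e); rewrite eoo leye_eq (negbTE boo).
pose n := maxn (\max_v nv v) (\max_e (ne e).+1).
have nb : n%:R%:E <= b.
  have maxb i j : i%:R%:E <= b -> j%:R%:E <= b -> (maxn i j)%:R%:E <= b.
    by rewrite /maxn; case: ltnP.
  have b0 : (0%N)%:R%:E <= b.
    by apply: le_trans (vb v0); rewrite (nvP v0).2 lee_fin ler_nat.
  have maxs := big_ind (fun k : nat => k%:R%:E <= b) b0 maxb.
  apply: (maxb); apply: maxs.
    by move=> v _; rewrite -(nvP v).2.
  by move=> e _; apply: le_trans (eb e); rewrite (neP e).2 -EFinD -natr1.
apply: le_trans nb; apply/asdim_leP.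
apply: (asdim_le_pi1 (S := S) (side := side) Spi Yconn Tmax) => [v|e].
  apply/asdim_leP; rewrite (nvP v).2 lee_fin ler_nat leq_max.
  by rewrite (leq_bigmax v).
by exists (ne e); [rewrite leq_max (leq_bigmax e) orbT|exact: (neP e).1].
Qed.
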